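(* Fix $\epsilon>0$ and a Følner sequence $\Phi$ on $\mathbb{N}$. Let $f_{\mathsf{Bes}}\in\mathsf{Bes}(\mathbb{N},\Phi)$ be bounded and non-negative, let $f_{\mathsf{anti}}\in\mathsf{Bes}(\mathbb{N},\Phi)^\perp$ be bounded and real-valued, and let $f_{\mathsf{c}}\in L^2(\mathbb{N},\Phi)$ be bounded, non-negative and compact along $\Phi$. Then there exist a subsequence $\Psi$ of $\Phi$ and an ultrafilter $\mathfrak{p}$ on $\mathbb{N}$ such that: (U1) $\overline{\mathsf{d}}_\Psi(E)>0$ for all $E\in\mathfrak{p}$; (U2) $\{n\in\mathbb{N}: \|\mathsf{R}^nf_{\mathsf{c}}-f_{\mathsf{c}}\|_\Psi<\epsilon/3\}\in\mathfrak{p}$; (U3) $\|\mathsf{R}^{\mathfrak{p}}f_{\mathsf{Bes}}-f_{\mathsf{Bes}}\|_\Psi<\epsilon/3$; (U4) $\langle f_{\mathsf{c}},\mathsf{R}^{\mathfrak{p}}f_{\mathsf{anti}}\rangle_\Psi$ is non-negative.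
   Context: A Følner sequence in $\mathbb{N}$ is a sequence $\Phi\colon N\mapsto\Phi_N$ of finite non-empty subsets of $\mathbb{N}$ with $|(\Phi_N+m)\triangle\Phi_N|/|\Phi_N|\to0$ for all $m\in\mathbb{N}$. $\overline{\mathsf{d}}_\Psi(E)=\limsup_N|E\cap\Psi_N|/|\Psi_N|$. $\|f\|_\Phi=\big(\limsup_{N\to\infty}\frac{1}{|\Phi_N|}\sum_{n\in\Phi_N}|f(n)|^2\big)^{1/2}$, $L^2(\mathbb{N},\Phi)=\{f:\|f\|_\Phi<\infty\}$, $\langle f,h\rangle_\Phi=\lim_{N\to\infty}\frac{1}{|\Phi_N|}\sum_{n\in\Phi_N}f(n)\overline{h(n)}$ when the limit exists. $(\mathsf{R}^mf)(n)=f(n+m)$ and for an ultrafilter $\mathfrak{p}$ and bounded $f$, $(\mathsf{R}^{\mathfrak{p}}f)(n)=\lim_{m\to\mathfrak{p}}f(n+m)$ (ultrafilter limit). A trigonometric polynomial is $n\mapsto\sum_{j=1}^Jc_je^{2\pi i\theta_jn}$ ($c_j\in\mathbb{C}$, $\theta_j\in[0,1)$); $\mathsf{Bes}(\mathbb{N},\Phi)$ is the set of $f$ that can be approximated arbitrarily well in $\|\cdot\|_\Phi$ by trigonometric polynomials; $\mathsf{Bes}(\mathbb{N},\Phi)^\perp$ is the set of $f\in L^2(\mathbb{N},\Phi)$ with $\lim_{N}\frac{1}{|\Phi_N|}\sum_{n\in\Phi_N}f(n)e^{2\pi in\theta}=0$ for all $\theta\in[0,1)$. $f\in L^2(\mathbb{N},\Phi)$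 is compact along $\Phi$ if for every $\delta>0$ there is $K$ with $\min_{1\le k\le K}\|\mathsf{R}^mf-\mathsf{R}^kf\|_\Phi<\delta$ for all $m\in\mathbb{N}$. *)

(* Defs.v *)
From Stdlib Require Import Reals Lra List Bool Arith ClassicalDescription ClassicalEpsilon.
From Coquelicot Require Import Coquelicot.
Import ListNotations.
Open Scope R_scope.

(** Finite subsets of the naturals are represented by duplicate-free lists. *)

Definition inb (l : list nat) (n : nat) : bool := existsb (Nat.eqb n) l.

Definition symdiff_shift_card (l : list nat) (m : nat) : nat :=
  length (filter (fun n => negb (inb l (n + m))) l)
  + length (filter (fun n => negb (existsb (fun k => Nat.eqb (k + m) n) l)) l).

Definition Folner (Phi : nat -> list nat) : Prop :=
  (forall N, NoDup (Phi N) /\ Phi N <> []) /\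
  (forall m : nat,
     is_lim_seq (fun N => INR (symdiff_shift_card (Phi N) m) / INR (length (Phi N))) 0).

Definition is_subsequence (Psi Phi : nat -> list nat) : Prop :=
  exists sigma : nat -> nat, (forall i j, (i < j)%nat -> (sigma i < sigma j)%nat) /\
    forall N, Psi N = Phi (sigma N).

Definition sumR (l : list nat) (f : nat -> R) : R := fold_right Rplus 0 (map f l).
Definition avgR (l : list nat) (f : nat -> R) : R := sumR l f / INR (length l).
Definition sumC (l : list nat) (f : nat -> C) : C := fold_right Cplus (RtoC 0) (map f l).
Definition avgC (l : list nat) (f : nat -> C) : C := Cmult (sumC l f) (RtoC (/ INR (length l))).

(** Square root on extended reals (only used on values >= 0). *)
Definition Rbar_sqrt (x : Rbar) : Rbar :=
  match x with
  | Finite r => Finite (sqrt r)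
  | p_infty => p_infty
  | m_infty => m_infty
  end.

Definition normC (Phi : nat -> list nat) (g : nat -> C) : Rbar :=
  Rbar_sqrt (LimSup_seq (fun N => avgR (Phi N) (fun n => (Cmod (g n)) ^ 2))).

Definition normR (Phi : nat -> list nat) (f : nat -> R) : Rbar :=
  normC Phi (fun n => RtoC (f n)).

Definition L2 (Phi : nat -> list nat) (f : nat -> R) : Prop :=
  Rbar_lt (normR Phi f) p_infty.

Definition e2pi (x : R) : C := (cos (2 * PI * x), sin (2 * PI * x)).

Definition trigpoly (P : list (C * R)%type) (n : nat) : C :=
  fold_right Cplus (RtoC 0) (map (fun ct => Cmult (fst ct) (e2pi (snd ct * INR n))) P).

Definition valid_freqs (P : list (C * R)%type) : Prop :=
  List.Forall (fun ct : (C * R)%type => 0 <= snd ct < 1) P.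

Definition in_Bes (Phi : nat -> list nat) (f : nat -> R) : Prop :=
  forall delta, 0 < delta ->
    exists P, valid_freqs P /\
      Rbar_lt (normC Phi (fun n => Cminus (RtoC (f n)) (trigpoly P n))) (Finite delta).

Definition in_Bes_perp (Phi : nat -> list nat) (f : nat -> R) : Prop :=
  L2 Phi f /\
  forall theta, 0 <= theta < 1 ->
    filterlim (fun N => avgC (Phi N) (fun n => Cmult (RtoC (f n)) (e2pi (INR n * theta))))
      eventually (locally (RtoC 0)).

Definition Rshift (m : nat) (f : nat -> R) : nat -> R := fun n => f (n + m)%nat.

Definition compact_along (Phi : nat -> list nat) (f : nat -> R) : Prop :=
  L2 Phi f /\
  forall delta, 0 < delta -> exists K : nat,
    forall m : nat, (1 <= m)%nat ->
      exists k : nat, (1 <= k <= K)%nat /\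
        Rbar_lt (normR Phi (fun n => Rshift m f n - Rshift k f n)) (Finite delta).

Definition bounded_seq (f : nat -> R) : Prop := exists B, forall n, Rabs (f n) <= B.

Definition is_ultrafilter (p : (nat -> Prop) -> Prop) : Prop :=
  p (fun _ => True) /\
  ~ p (fun _ => False) /\
  (forall A B : nat -> Prop, (forall n, A n -> B n) -> p A -> p B) /\
  (forall A B : nat -> Prop, p A -> p B -> p (fun n => A n /\ B n)) /\
  (forall A : nat -> Prop, p A \/ p (fun n => ~ A n)).

Definition indicator (E : nat -> Prop) (n : nat) : bool :=
  if excluded_middle_informative (E n) then true else false.

Definition upper_density (Psi : nat -> list nat) (E : nat -> Prop) : Rbar :=
  LimSup_seq (fun N => INR (length (filter (indicator E) (Psi N))) / INR (length (Psi N))).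

Definition is_ulim (p : (nat -> Prop) -> Prop) (u : nat -> R) (L : R) : Prop :=
  forall eps, 0 < eps -> p (fun m => Rabs (u m - L) < eps).

Definition ulim (p : (nat -> Prop) -> Prop) (u : nat -> R) : R :=
  epsilon (inhabits 0) (fun L => is_ulim p u L).

Definition ushift (p : (nat -> Prop) -> Prop) (f : nat -> R) : nat -> R :=
  fun n => ulim p (fun m => f (n + m)%nat).

Definition inner_is (Psi : nat -> list nat) (f h : nat -> R) (l : R) : Prop :=
  is_lim_seq (fun N => avgR (Psi N) (fun n => f n * h n)) l.

(* Main.v *)
(* Let [E] be an invariant mean, the limit of the averages over [Phi] along a free
   ultrafilter [U].  Let [h m] be the autocorrelation of the indicator of a small ball
   around 0 for the pseudometric measuring both [R^m fc] and a trigonometric polynomial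
   close to [fBes].  Then [h] is supported where (U2) holds, has positive mean by total
   boundedness, and is the Fourier transform of a positive (finitely additive) measure
   on the circle; so, by bounded convergence, [h] is orthogonal to all translates of
   [fanti].  Hence the correlations
     [G N m] = average over [n] in [Phi N] of [fc n * fanti (n + m)]
   all have mean 0 for the mean [lam f = E (h * f)], and this forces a uniform lower
   bound [c] for the [lam]-measure of [{G N >= - d}], for every [d > 0] and [U]-many
   [N].  Bergelson's intersectivity lemma applied to such sets with [d = 1/(j+1)] and
   [N = s j], intersected with the almost full sets where the error of the
   trigonometric approximation is small on average, gives an ultrafilter [p0]
   containing infinitely many of them; this yields (U3) and (U4) along a subsequence.
   The functions [R^p0 fBes] and [R^p0 fanti] depend on countably many members of [p0],
   whose densities are controlled along [s] in advance, so [p0] can finally be replaced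
   by an ultrafilter with the same limits all of whose members have positive upper
   density along the chosen subsequence. *)
Require Import Defs.
From mathcomp Require filter.
From Stdlib Require Import Reals Lra Lia List ZArith Arith Permutation ClassicalEpsilon Classical.
From Stdlib Require FunctionalExtensionality FinFun.
From Coquelicot Require Import Coquelicot.
Import ListNotations.
Open Scope R_scope.

Lemma choice_fun {A B : Type} (Q : A -> B -> Prop) :
  (forall a, exists b, Q a b) -> exists f, forall a, Q a (f a).
Proof.
intros H.
exists (fun a => proj1_sig (constructive_indefinite_description _ (H a))).
intros a; exact (proj2_sig (constructive_indefinite_description _ (H a))).
Qed.

(** * Ultrafilters *)

(** Stated over any type because an ultrafilter on the reals occurs in [bounded_convergence]; on
    [nat] it unfolds to [is_ultrafilter]. *)
Definition is_ultra {T : Type} (p : (T -> Prop) -> Prop) : Prop :=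
  p (fun _ => True) /\
  ~ p (fun _ => False) /\
  (forall A B : T -> Prop, (forall n, A n -> B n) -> p A -> p B) /\
  (forall A B : T -> Prop, p A -> p B -> p (fun n => A n /\ B n)) /\
  (forall A : T -> Prop, p A \/ p (fun n => ~ A n)).

(** The hypotheses say that [F] is a proper filter, so Zorn's lemma applies. Every ultrafilter below
    comes from a suitable choice of [F]. *)
Lemma ultra_extend (T : Type) (F : (T -> Prop) -> Prop) :
  F (fun _ => True) -> ~ F (fun _ => False) ->
  (forall A B : T -> Prop, (forall x, A x -> B x) -> F A -> F B) ->
  (forall A B : T -> Prop, F A -> F B -> F (fun x => A x /\ B x)) ->
  exists p, is_ultra p /\ forall A, F A -> p A.
Proof.
intros FT Fn Fs Fi.
destruct (@filter.ultraFilterLemma T F) as [G [GU GF]].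
{ apply filter.Build_ProperFilter; [exact Fn |].
  apply filter.Build_Filter; [exact FT | exact Fi | exact Fs]. }
exists G; split; [| exact GF].
pose proof (@filter.ultra_proper _ _ GU) as GP.
pose proof (@filter.filter_filter _ _ GP) as Gf.
split; [exact (GF _ FT) |].
split; [exact (@filter.filter_not_empty _ _ GP) |].
split; [intros A B; exact (@filter.filterS _ _ Gf A B) |].
split; [intros A B; exact (@filter.filterI _ _ Gf A B) |].
intros A; exact (@filter.in_ultra_setVsetC _ _ A GU).
Qed.

Section Ultra.
Context {T : Type} (p : (T -> Prop) -> Prop) (Hp : is_ultra p).

Lemma ultra_sub (A B : T -> Prop) : p A -> (forall x, A x -> B x) -> p B.
Proof. destruct Hp as [_ [_ [H _]]]; intros HA HAB; exact (H A B HAB HA). Qed.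

Lemma ultra_and (A B : T -> Prop) : p A -> p B -> p (fun x => A x /\ B x).
Proof. destruct Hp as [_ [_ [_ [H _]]]]; exact (H A B). Qed.

Lemma ultra_all (A : T -> Prop) : (forall x, A x) -> p A.
Proof. destruct Hp as [H _]; intros HA; apply (ultra_sub _ _ H); auto. Qed.

Lemma ultra_ex (A : T -> Prop) : p A -> exists x, A x.
Proof.
intros HA; apply NNPP; intros Hn.
destruct Hp as [_ [H _]]; apply H; apply (ultra_sub _ _ HA).
intros x Hx; apply Hn; exists x; exact Hx.
Qed.

Lemma ultra_not (A : T -> Prop) : ~ p A -> p (fun x => ~ A x).
Proof. destruct Hp as [_ [_ [_ [_ H]]]]; destruct (H A); tauto. Qed.

Lemma ultra_not_both (A : T -> Prop) : p A -> p (fun x => ~ A x) -> False.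
Proof.
intros H1 H2; destruct (ultra_ex _ (ultra_and _ _ H1 H2)) as [x Hx]; tauto.
Qed.

Lemma ultra_forall_le (k : nat) (A : nat -> T -> Prop) :
  (forall i, (i <= k)%nat -> p (A i)) -> p (fun x => forall i, (i <= k)%nat -> A i x).
Proof.
intros H; induction k as [|k IH].
- apply (ultra_sub _ _ (H 0%nat (Nat.le_refl 0))).
  intros x Hx i Hi; assert (i = 0)%nat by lia; subst; exact Hx.
- apply (ultra_sub (fun x => (forall i, (i <= k)%nat -> A i x) /\ A (S k) x)).
  + apply ultra_and; [apply IH; intros i Hi; apply H; lia | apply H; lia].
  + intros x [H1 H2] i Hi; destruct (Nat.eq_dec i (S k)); [subst; auto | apply H1; lia].
Qed.

Lemma ultra_ex_lt (k : nat) (A : nat -> T -> Prop) :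
  p (fun x => exists i, (i < k)%nat /\ A i x) -> exists i, (i < k)%nat /\ p (A i).
Proof.
induction k as [|k IH]; intros H.
- destruct (ultra_ex _ H) as [x [i [Hi _]]]; lia.
- destruct (classic (p (A k))) as [Hk|Hk]; [exists k; split; [lia | exact Hk] |].
  destruct IH as [i [Hi HA]]; [| exists i; split; [lia | exact HA]].
  apply (ultra_sub _ _ (ultra_and _ _ H (ultra_not _ Hk))).
  intros x [[i [Hi HA]] Hn].
  destruct (Nat.eq_dec i k); [subst; contradiction | exists i; split; [lia | exact HA]].
Qed.

(** On [nat] this and [ulimit] unfold to [is_ulim] and [ulim], so that [ulimit_eq] can compute
    values of [ushift]. *)
Definition is_ulimit (u : T -> R) (L : R) : Prop :=
  forall e, 0 < e -> p (fun x => Rabs (u x - L) < e).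

Definition ulimit (u : T -> R) : R := epsilon (inhabits 0) (fun L => is_ulimit u L).

Lemma is_ulimit_ex (u : T -> R) : (exists B, forall x, Rabs (u x) <= B) -> exists L, is_ulimit u L.
Proof.
intros [B HB].
(* The limit is the supremum of the levels [t] that [u] reaches or exceeds on a member of [p]. *)
destruct (completeness (fun t => p (fun x => t <= u x))) as [L [HL1 HL2]].
- exists B; intros t Ht; destruct (ultra_ex _ Ht) as [x Hx].
  specialize (HB x); apply Rabs_le_between in HB; lra.
- exists (- B); apply ultra_all; intros x.
  specialize (HB x); apply Rabs_le_between in HB; lra.
- exists L; intros e He.
  assert (H1 : p (fun x => ~ (L + e / 2 <= u x))).
  { apply ultra_not; intros Hc; specialize (HL1 _ Hc); lra. }
  assert (H2 : p (fun x => L - e / 2 <= u x)).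
  { apply NNPP; intros Hc.
    assert (L <= L - e / 2); [| lra].
    apply HL2; intros t Ht; apply Rnot_lt_le; intros Hlt; apply Hc.
    apply (ultra_sub _ _ Ht); intros x Hx; lra. }
  apply (ultra_sub _ _ (ultra_and _ _ H1 H2)).
  intros x [Ha Hb]; apply Rabs_def1; lra.
Qed.

Lemma ulimit_correct (u : T -> R) :
  (exists B, forall x, Rabs (u x) <= B) -> is_ulimit u (ulimit u).
Proof.
intros H; unfold ulimit; apply epsilon_spec; exact (is_ulimit_ex u H).
Qed.

Lemma is_ulimit_le (u v : T -> R) (a b : R) :
  is_ulimit u a -> is_ulimit v b -> p (fun x => u x <= v x) -> a <= b.
Proof.
intros Hu Hv H; apply Rnot_lt_le; intros Hlt.
destruct (ultra_ex _ (ultra_and _ _ H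
  (ultra_and _ _ (Hu ((a - b) / 2) ltac:(lra)) (Hv ((a - b) / 2) ltac:(lra)))))
  as [x [H1 [H2 H3]]].
apply Rabs_def2 in H2; apply Rabs_def2 in H3; lra.
Qed.

Lemma is_ulimit_unique (u : T -> R) (a b : R) : is_ulimit u a -> is_ulimit u b -> a = b.
Proof.
intros Ha Hb; apply Rle_antisym; [apply (is_ulimit_le u u) | apply (is_ulimit_le u u)];
  auto; apply ultra_all; intros; lra.
Qed.

Lemma ulimit_eq (u : T -> R) (L : R) : is_ulimit u L -> ulimit u = L.
Proof.
intros H; apply (is_ulimit_unique u); [| exact H].
unfold ulimit; apply epsilon_spec; exists L; exact H.
Qed.

Lemma is_ulimit_plus (u v : T -> R) (a b : R) :
  is_ulimit u a -> is_ulimit v b -> is_ulimit (fun x => u x + v x) (a + b).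
Proof.
intros Hu Hv e He.
apply (ultra_sub _ _ (ultra_and _ _ (Hu (e / 2) ltac:(lra)) (Hv (e / 2) ltac:(lra)))).
intros x [H1 H2]; apply Rabs_def2 in H1; apply Rabs_def2 in H2; apply Rabs_def1; lra.
Qed.

Lemma is_ulimit_scal (c : R) (u : T -> R) (a : R) :
  is_ulimit u a -> is_ulimit (fun x => c * u x) (c * a).
Proof.
intros Hu e He.
assert (Hc : 0 < Rabs c + 1) by (pose proof (Rabs_pos c); lra).
assert (He' : 0 < e / (Rabs c + 1)) by (apply Rdiv_lt_0_compat; lra).
apply (ultra_sub _ _ (Hu _ He')); intros x Hx.
rewrite <- Rmult_minus_distr_l, Rabs_mult.
apply Rle_lt_trans with (Rabs c * (e / (Rabs c + 1))).
- apply Rmult_le_compat_l; [apply Rabs_pos | lra].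
- apply Rlt_le_trans with ((Rabs c + 1) * (e / (Rabs c + 1))); [| right; field; lra].
  apply Rmult_lt_compat_r; lra.
Qed.

Lemma is_ulimit_ext (u v : T -> R) (a : R) :
  p (fun x => u x = v x) -> is_ulimit u a -> is_ulimit v a.
Proof.
intros H Hu e He; apply (ultra_sub _ _ (ultra_and _ _ H (Hu e He))).
intros x [H1 H2]; rewrite <- H1; exact H2.
Qed.

Lemma is_ulimit_const (c : R) : is_ulimit (fun _ => c) c.
Proof.
intros e He; apply ultra_all; intros _; rewrite Rminus_diag, Rabs_R0; exact He.
Qed.

End Ultra.

Lemma free_ultra_ex : exists p : (nat -> Prop) -> Prop,
  is_ultra p /\ forall A, eventually A -> p A.
Proof.
apply ultra_extend.
- exists 0%nat; auto.
- intros [N H]; exact (H N (Nat.le_refl N)).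
- intros A B HAB [N H]; exists N; auto.
- intros A B [N H] [M K]; exists (N + M)%nat; intros n Hn; split; [apply H | apply K]; lia.
Qed.

Lemma increasing_selection (S : nat -> nat -> Prop) :
  (forall j n, exists m, (n < m)%nat /\ S j m) ->
  exists s : nat -> nat, (forall i j, (i < j)%nat -> (s i < s j)%nat) /\ forall j, S j (s j).
Proof.
intros H.
destruct (choice_fun (fun (jn : nat * nat) m => (snd jn < m)%nat /\ S (fst jn) m)) as [f Hf].
{ intros [j n]; exact (H j n). }
set (s := fix s j := match j with 0%nat => f (0%nat, 0%nat)
                     | Datatypes.S i => f (Datatypes.S i, s i) end).
assert (Hs : forall j, (s j < s (Datatypes.S j))%nat).
{ intros j; exact (proj1 (Hf (Datatypes.S j, s j))). }
exists s; split.
- intros i j Hij; induction Hij as [|j Hij IH]; [apply Hs |].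
  apply (Nat.lt_trans _ _ _ IH (Hs j)).
- intros [|j]; [exact (proj2 (Hf (0%nat, 0%nat))) | exact (proj2 (Hf (Datatypes.S j, s j)))].
Qed.

Lemma increasing_ge_id (s : nat -> nat) :
  (forall i j, (i < j)%nat -> (s i < s j)%nat) -> forall n, (n <= s n)%nat.
Proof.
intros H n; induction n as [|n IH]; [lia | specialize (H n (S n) ltac:(lia)); lia].
Qed.

(** * Means *)

Definition bdd {X : Type} (f : X -> R) : Prop := exists B, forall x, Rabs (f x) <= B.

Definition ind (P : Prop) : R := if excluded_middle_informative P then 1 else 0.

Lemma ind_spec (P : Prop) : (P /\ ind P = 1) \/ (~ P /\ ind P = 0).
Proof. unfold ind; destruct (excluded_middle_informative P); tauto. Qed.

Ltac ind_cases :=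
  repeat match goal with
  | |- context [ind ?P] => destruct (ind_spec P) as [[? ->]|[? ->]]
  end.

Lemma ind_bounds (P : Prop) : 0 <= ind P <= 1.
Proof. ind_cases; lra. Qed.

Lemma bdd_const {X : Type} (c : R) : bdd (fun _ : X => c).
Proof. exists (Rabs c); intros; lra. Qed.

Lemma bdd_ind {X : Type} (P : X -> Prop) : bdd (fun x => ind (P x)).
Proof. exists 1; intros x; pose proof (ind_bounds (P x)); apply Rabs_le; lra. Qed.

Lemma bdd_plus {X : Type} (f g : X -> R) : bdd f -> bdd g -> bdd (fun x => f x + g x).
Proof.
intros [A HA] [B HB]; exists (A + B); intros x.
apply Rle_trans with (1 := Rabs_triang _ _); specialize (HA x); specialize (HB x); lra.
Qed.

Lemma bdd_mult {X : Type} (f g : X -> R) : bdd f -> bdd g -> bdd (fun x => f x * g x).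
Proof.
intros [A HA] [B HB]; exists (A * B); intros x; rewrite Rabs_mult.
apply Rmult_le_compat; auto using Rabs_pos.
Qed.

Lemma bdd_opp {X : Type} (f : X -> R) : bdd f -> bdd (fun x => - f x).
Proof. intros [A HA]; exists A; intros x; rewrite Rabs_Ropp; auto. Qed.

Lemma bdd_minus {X : Type} (f g : X -> R) : bdd f -> bdd g -> bdd (fun x => f x - g x).
Proof. intros Hf Hg; apply bdd_plus; [exact Hf | apply bdd_opp; exact Hg]. Qed.

Lemma bdd_comp {X Y : Type} (f : Y -> R) (s : X -> Y) : bdd f -> bdd (fun x => f (s x)).
Proof. intros [A HA]; exists A; intros x; apply HA. Qed.

Lemma bdd_pow2 {X : Type} (f : X -> R) : bdd f -> bdd (fun x => f x ^ 2).
Proof.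
intros Hf; apply bdd_mult; [exact Hf | apply bdd_mult; [exact Hf | apply bdd_const]].
Qed.

Lemma bdd_pos {X : Type} (f : X -> R) : bdd f -> exists B, 0 < B /\ forall x, Rabs (f x) <= B.
Proof.
intros [B HB]; exists (Rmax B 1); split.
- apply Rlt_le_trans with (2 := Rmax_r _ _); lra.
- intros x; apply Rle_trans with (2 := Rmax_l _ _); apply HB.
Qed.

Lemma sumR_cons (a : nat) l f : sumR (a :: l) f = f a + sumR l f.
Proof. reflexivity. Qed.

Lemma sumR_app l m f : sumR (l ++ m) f = sumR l f + sumR m f.
Proof.
induction l as [|a l IH]; simpl; [unfold sumR; simpl; lra |].
change (f a + sumR (l ++ m) f = f a + sumR l f + sumR m f); lra.
Qed.

Lemma sumR_ext l f g : (forall n, In n l -> f n = g n) -> sumR l f = sumR l g.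
Proof.
induction l as [|a l IH]; intros H; [reflexivity |].
change (f a + sumR l f = g a + sumR l g).
rewrite IH, (H a); [reflexivity | left; reflexivity | intros; apply H; right; assumption].
Qed.

Lemma sumR_le l f g : (forall n, In n l -> f n <= g n) -> sumR l f <= sumR l g.
Proof.
induction l as [|a l IH]; intros H; [right; reflexivity |].
change (f a + sumR l f <= g a + sumR l g).
apply Rplus_le_compat; [apply H; left; reflexivity | apply IH; intros; apply H; right; assumption].
Qed.

Lemma sumR_plus l f g : sumR l (fun n => f n + g n) = sumR l f + sumR l g.
Proof.
induction l as [|a l IH]; [unfold sumR; simpl; lra |].
change (f a + g a + sumR l (fun n => f n + g n) = f a + sumR l f + (g a + sumR l g)); lra.
Qed.

Lemma sumR_scal l c f : sumR l (fun n => c * f n) = c * sumR l f.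
Proof.
induction l as [|a l IH]; [unfold sumR; simpl; lra |].
change (c * f a + sumR l (fun n => c * f n) = c * (f a + sumR l f)); lra.
Qed.

Lemma sumR_const l c : sumR l (fun _ => c) = INR (length l) * c.
Proof.
induction l as [|a l IH]; [unfold sumR; simpl; lra |].
change (c + sumR l (fun _ => c) = INR (S (length l)) * c); rewrite S_INR; lra.
Qed.

Lemma sumR_swap l m (F : nat -> nat -> R) :
  sumR l (fun i => sumR m (fun j => F i j)) = sumR m (fun j => sumR l (fun i => F i j)).
Proof.
induction l as [|a l IH].
- transitivity (sumR m (fun _ => 0)); [| reflexivity].
  rewrite sumR_const; unfold sumR at 1; simpl; lra.
- change (sumR m (F a) + sumR l (fun i => sumR m (fun j => F i j))
          = sumR m (fun j => F a j + sumR l (fun i => F i j))).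
  rewrite sumR_plus, IH; reflexivity.
Qed.

Lemma sumR_abs l f : Rabs (sumR l f) <= sumR l (fun n => Rabs (f n)).
Proof.
induction l as [|a l IH]; [unfold sumR; simpl; rewrite Rabs_R0; lra |].
change (Rabs (f a + sumR l f) <= Rabs (f a) + sumR l (fun n => Rabs (f n))).
apply Rle_trans with (1 := Rabs_triang _ _); lra.
Qed.

Lemma sumR_map (s : nat -> nat) l f : sumR (map s l) f = sumR l (fun n => f (s n)).
Proof. unfold sumR; rewrite map_map; reflexivity. Qed.

Lemma sumR_perm l m f : Permutation l m -> sumR l f = sumR m f.
Proof.
induction 1 as [|x l m H IH|x y l|l m k H1 IH1 H2 IH2].
- reflexivity.
- change (f x + sumR l f = f x + sumR m f); lra.
- change (f y + (f x + sumR l f) = f x + (f y + sumR l f)); lra.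
- congruence.
Qed.

Lemma sumR_filter l (b : nat -> bool) f :
  sumR l (fun n => (if b n then 1 else 0) * f n) = sumR (filter b l) f.
Proof.
induction l as [|a l IH]; [reflexivity |].
change ((if b a then 1 else 0) * f a + sumR l (fun n => (if b n then 1 else 0) * f n)
        = sumR (filter b (a :: l)) f).
rewrite IH; simpl; destruct (b a); [| lra].
change (1 * f a + sumR (filter b l) f = f a + sumR (filter b l) f); lra.
Qed.

Lemma avgR_ext l f g : (forall n, In n l -> f n = g n) -> avgR l f = avgR l g.
Proof. intros H; unfold avgR; rewrite (sumR_ext l f g H); reflexivity. Qed.

Lemma avgR_plus l f g : avgR l (fun n => f n + g n) = avgR l f + avgR l g.
Proof. unfold avgR; rewrite sumR_plus; unfold Rdiv; lra. Qed.

Lemma avgR_scal l c f : avgR l (fun n => c * f n) = c * avgR l f.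
Proof. unfold avgR; rewrite sumR_scal; unfold Rdiv; lra. Qed.

Lemma inv_length_pos (l : list nat) : 0 <= / INR (length l).
Proof.
destruct l as [|a l]; [simpl; rewrite Rinv_0; lra |].
left; apply Rinv_0_lt_compat, lt_0_INR; simpl; lia.
Qed.

Lemma avgR_le l f g : (forall n, In n l -> f n <= g n) -> avgR l f <= avgR l g.
Proof.
intros H; unfold avgR, Rdiv; apply Rmult_le_compat_r; [apply inv_length_pos |].
apply sumR_le; exact H.
Qed.

Lemma avgR_const l c : l <> [] -> avgR l (fun _ => c) = c.
Proof.
intros H; unfold avgR; rewrite sumR_const; field.
destruct l as [|a l]; [contradiction | apply not_0_INR; simpl; lia].
Qed.

Lemma avgR_nonneg l f : (forall n, In n l -> 0 <= f n) -> 0 <= avgR l f.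
Proof.
intros H; destruct l as [|a l]; [unfold avgR, sumR; simpl; unfold Rdiv; lra |].
rewrite <- (avgR_const (a :: l) 0) by discriminate; apply avgR_le; exact H.
Qed.

Lemma avgR_abs l f : Rabs (avgR l f) <= avgR l (fun n => Rabs (f n)).
Proof.
unfold avgR, Rdiv; rewrite Rabs_mult, (Rabs_pos_eq (/ _)) by apply inv_length_pos.
apply Rmult_le_compat_r; [apply inv_length_pos | apply sumR_abs].
Qed.

Lemma avgR_abs_le l f B : 0 <= B -> (forall n, Rabs (f n) <= B) -> Rabs (avgR l f) <= B.
Proof.
intros HB H; destruct l as [|a l].
{ unfold avgR, sumR, Rdiv; simpl; rewrite Rmult_0_l, Rabs_R0; exact HB. }
apply Rle_trans with (1 := avgR_abs _ _).
rewrite <- (avgR_const (a :: l) B) by discriminate; apply avgR_le; auto.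
Qed.

Lemma bdd_avgR {X : Type} (l : X -> list nat) (F : X -> nat -> R) (B : R) :
  (forall x n, Rabs (F x n) <= B) -> bdd (fun x => avgR (l x) (F x)).
Proof.
intros HF; exists (Rmax B 0); intros x; apply avgR_abs_le; [apply Rmax_r |].
intros n; apply Rle_trans with (2 := Rmax_l _ _); apply HF.
Qed.

(** Integration of bounded functions against a finitely additive positive measure. The mass
    [M (fun _ => 1)] is left free, so that weighted means and spectral measures are covered too. *)
Record is_mean {X : Type} (M : (X -> R) -> R) : Prop := {
  mean_plus : forall f g, bdd f -> bdd g -> M (fun x => f x + g x) = M f + M g;
  mean_scal : forall c f, bdd f -> M (fun x => c * f x) = c * M f;
  mean_nonneg : forall f, bdd f -> (forall x, 0 <= f x) -> 0 <= M f }.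

Section Mean.
Context {X : Type} (M : (X -> R) -> R) (HM : is_mean M).

Lemma mean_le f g : bdd f -> bdd g -> (forall x, f x <= g x) -> M f <= M g.
Proof.
intros Hf Hg H.
assert (Hg' : bdd (fun x => -1 * f x)) by (apply bdd_mult; [apply bdd_const | exact Hf]).
pose proof (mean_nonneg M HM (fun x => g x + -1 * f x) (bdd_plus _ _ Hg Hg')) as Hn.
rewrite (mean_plus M HM), (mean_scal M HM) in Hn by assumption.
assert (0 <= M g + -1 * M f); [apply Hn; intros x; specialize (H x) |]; lra.
Qed.

Lemma mean_ext f g : bdd f -> (forall x, f x = g x) -> M f = M g.
Proof.
intros Hf H.
assert (Hg : bdd g) by (destruct Hf as [B HB]; exists B; intros x; rewrite <- H; auto).
apply Rle_antisym; apply mean_le; auto; intros x; rewrite H; lra.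
Qed.

Lemma mean_const c : M (fun _ => c) = c * M (fun _ => 1).
Proof.
rewrite <- (mean_scal M HM) by apply bdd_const.
apply mean_ext; [apply bdd_const | intros; lra].
Qed.

Lemma mean_sumR (l : list nat) (F : nat -> X -> R) : (forall i, bdd (F i)) ->
  bdd (fun x => sumR l (fun i => F i x)) /\
  M (fun x => sumR l (fun i => F i x)) = sumR l (fun i => M (F i)).
Proof.
intros HF; induction l as [|a l [IHb IH]].
- split; [apply (bdd_const 0) |].
  change (M (fun _ => 0) = 0); rewrite mean_const; lra.
- split; [apply (bdd_plus (F a) _ (HF a) IHb) |].
  change (M (fun x => F a x + sumR l (fun i => F i x)) = M (F a) + sumR l (fun i => M (F i))).
  rewrite (mean_plus M HM) by auto; rewrite IH; reflexivity.
Qed.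

Lemma mean_avgR (l : list nat) (F : nat -> X -> R) : (forall i, bdd (F i)) ->
  M (fun x => avgR l (fun i => F i x)) = avgR l (fun i => M (F i)).
Proof.
intros HF; destruct (mean_sumR l F HF) as [Hb HE].
unfold avgR, Rdiv; rewrite <- HE, Rmult_comm, <- (mean_scal M HM) by exact Hb.
apply mean_ext; [| intros; apply Rmult_comm].
apply bdd_mult; [exact Hb | apply bdd_const].
Qed.

Lemma mean_ind_bounds (P : X -> Prop) :
  0 <= M (fun x => ind (P x)) <= M (fun _ => 1).
Proof.
split; [apply (mean_nonneg M HM); [apply bdd_ind | intros; apply ind_bounds] |].
apply mean_le; [apply bdd_ind | apply bdd_const | intros; apply ind_bounds].
Qed.

End Mean.

(** * Intersectivity and bounded convergence for finitely additive measures *)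

Lemma sup_approx (u : nat -> R) (B e : R) :
  (forall k, u k <= B) -> 0 < e -> exists K, forall k, u k <= u K + e.
Proof.
intros HB He.
destruct (completeness (fun t => exists k, t = u k)) as [s [Hs1 Hs2]].
- exists B; intros t [k ->]; apply HB.
- exists (u 0%nat), 0%nat; reflexivity.
- apply NNPP; intros Hn.
  assert (s <= s - e); [| lra].
  apply Hs2; intros t [K ->]; apply Rnot_lt_le; intros Hlt; apply Hn; exists K.
  intros k; assert (u k <= s) by (apply Hs1; exists k; reflexivity); lra.
Qed.

(* A finitely additive form of Bergelson's intersectivity lemma.  Replacing tails
   of [A] by finite unions [U s] of almost maximal measure makes
   [T r = U 0 /\ ... /\ U (r-1)] of measure at least [c/2] for all [r]; the sets
   with [T r \ E] asymptotically null form a filter containing every [U s] and the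
   complement of every null set. *)
Lemma intersectivity {X : Type} (M : (X -> R) -> R) (A : nat -> X -> Prop) (c : R) :
  is_mean M -> 0 < c -> (forall j, c <= M (fun x => ind (A j x))) ->
  exists p : (X -> Prop) -> Prop, is_ultra p /\
    (forall E, p E -> 0 < M (fun x => ind (E x))) /\
    (forall i, exists j, (i <= j)%nat /\ p (A j)).
Proof.
intros HM Hc HA.
set (mu := fun P : X -> Prop => M (fun x => ind (P x))).
assert (mu_sub2 : forall P Q S : X -> Prop, (forall x, P x -> Q x \/ S x) -> mu P <= mu Q + mu S).
{ intros P Q S H; unfold mu; rewrite <- (mean_plus M HM) by apply bdd_ind.
  apply (mean_le M HM); [apply bdd_ind | apply bdd_plus; apply bdd_ind |].
  intros x; specialize (H x); ind_cases; try lra; tauto. }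
assert (mu_disj : forall P Q S : X -> Prop, (forall x, P x -> S x) -> (forall x, Q x -> S x) ->
  (forall x, P x -> Q x -> False) -> mu P + mu Q <= mu S).
{ intros P Q S H1 H2 H3; unfold mu; rewrite <- (mean_plus M HM) by apply bdd_ind.
  apply (mean_le M HM); [apply bdd_plus; apply bdd_ind | apply bdd_ind |].
  intros x; specialize (H1 x); specialize (H2 x); specialize (H3 x); ind_cases; try lra; tauto. }
assert (mu_pos : forall P, 0 <= mu P) by (intros P; apply (mean_ind_bounds M HM)).
assert (mu_sub : forall P Q : X -> Prop, (forall x, P x -> Q x) -> mu P <= mu Q).
{ intros P Q H; apply (mean_le M HM); [apply bdd_ind | apply bdd_ind |].
  intros x; specialize (H x); ind_cases; try lra; tauto. }
set (U := fun i K x => exists j, (i <= j < K)%nat /\ A j x).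
(* The allowed losses [c / 4 * (1 / 2) ^ s] add up to [c / 2], half of the lower bound for each
   [A j]. *)
destruct (choice_fun (fun s K => forall k, mu (U s k) <= mu (U s K) + c / 4 * (1 / 2) ^ s)) as [K HK].
{ intros s; apply (sup_approx (fun k => mu (U s k)) (M (fun _ => 1))).
  - intros k; apply (mean_ind_bounds M HM).
  - apply Rmult_lt_0_compat; [lra | apply pow_lt; lra]. }
assert (HAU : forall s j, (s <= j)%nat ->
  mu (fun x => A j x /\ ~ U s (K s) x) <= c / 4 * (1 / 2) ^ s).
{ intros s j Hsj.
  (* The two sets are disjoint and lie in a longer union, whose measure exceeds that of [U s (K s)]
     by at most the allowed loss. *)
  assert (mu (U s (K s)) + mu (fun x => A j x /\ ~ U s (K s) x) <= mu (U s (K s + S j)%nat)).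
  { apply mu_disj.
    - intros x [i [Hi HAi]]; exists i; split; [lia | exact HAi].
    - intros x [HAj _]; exists j; split; [lia | exact HAj].
    - tauto. }
  specialize (HK s (K s + S j)%nat); lra. }
set (T := fun r x => forall s, (s < r)%nat -> U s (K s) x).
assert (HAT : forall r j, (r <= j)%nat ->
  mu (fun x => A j x /\ ~ T r x) <= c / 2 * (1 - (1 / 2) ^ r)).
{ induction r as [|r IH]; intros j Hj.
  - simpl; replace (c / 2 * (1 - 1)) with (0 * M (fun _ : X => 1)) by lra.
    rewrite <- (mean_const M HM); apply (mean_le M HM); [apply bdd_ind | apply bdd_const |].
    intros x; ind_cases; try lra; exfalso.
    destruct H as [_ H]; apply H; intros s Hs; lia.
  - apply Rle_trans with
      (mu (fun x => A j x /\ ~ T r x) + mu (fun x => A j x /\ ~ U r (K r) x)).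
    + apply mu_sub2; intros x [H1 H2].
      destruct (classic (T r x)) as [HT|HT]; [right | left; tauto].
      split; [exact H1 |]; intros HU; apply H2; intros s Hs.
      destruct (Nat.eq_dec s r); [subst; exact HU | apply HT; lia].
    + specialize (IH j ltac:(lia)); specialize (HAU r j ltac:(lia)); simpl.
      lra. }
assert (HT : forall r, c / 2 <= mu (T r)).
{ intros r; specialize (HAT r r (Nat.le_refl r)).
  assert (mu (A r) <= mu (T r) + mu (fun x => A r x /\ ~ T r x)).
  { apply mu_sub2; intros x Hx; destruct (classic (T r x)); tauto. }
  specialize (HA r); fold (mu (A r)) in HA.
  assert (0 <= c / 2 * (1 / 2) ^ r) by (apply Rmult_le_pos; [lra | apply pow_le; lra]).
  lra. }
destruct (ultra_extend X (fun E => forall e, 0 < e -> exists r0, forall r, (r0 <= r)%nat ->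
  mu (fun x => T r x /\ ~ E x) < e)) as [p [Hp HF]].
- intros e He; exists 0%nat; intros r _.
  apply Rle_lt_trans with (2 := He).
  replace 0 with (0 * M (fun _ : X => 1)) by lra; rewrite <- (mean_const M HM).
  apply (mean_le M HM); [apply bdd_ind | apply bdd_const |].
  intros x; ind_cases; try lra; tauto.
(* Properness: the measure of [T r] never drops below [c / 2]. *)
- intros H; destruct (H (c / 2) ltac:(lra)) as [r Hr].
  specialize (Hr r (Nat.le_refl r)); specialize (HT r).
  assert (mu (T r) <= mu (fun x => T r x /\ ~ False)) by (apply mu_sub; tauto); lra.
- intros P Q HPQ H e He; destruct (H e He) as [r0 H0]; exists r0; intros r Hr.
  apply Rle_lt_trans with (2 := H0 r Hr), mu_sub; intros x; specialize (HPQ x); tauto.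
- intros P Q H1 H2 e He.
  destruct (H1 (e / 2) ltac:(lra)) as [r1 K1]; destruct (H2 (e / 2) ltac:(lra)) as [r2 K2].
  exists (r1 + r2)%nat; intros r Hr.
  specialize (K1 r ltac:(lia)); specialize (K2 r ltac:(lia)).
  apply Rle_lt_trans with (mu (fun x => T r x /\ ~ P x) + mu (fun x => T r x /\ ~ Q x)); [| lra].
  apply mu_sub2; intros x; destruct (classic (P x)); tauto.
- exists p; split; [exact Hp | split].
  + intros E HE; apply Rnot_le_lt; intros Hle.
    apply (ultra_not_both p Hp E HE), HF; intros e He; exists 0%nat; intros r _.
    apply Rle_lt_trans with (2 := He), Rle_trans with (2 := Hle).
    apply (mu_sub _ E); intros x [_ H]; apply NNPP; exact H.
  + intros i.
    (* [T r] lies in [U i (K i)] as soon as [r > i]; being a finite union, a member of [p], it has a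
       piece in [p]. *)
    assert (HU : p (U i (K i))).
    { apply HF; intros e He; exists (S i); intros r Hr.
      apply Rle_lt_trans with (2 := He).
      replace 0 with (0 * M (fun _ : X => 1)) by lra; rewrite <- (mean_const M HM).
      apply (mean_le M HM); [apply bdd_ind | apply bdd_const |].
      intros x; ind_cases; try lra; exfalso.
      destruct H as [H1 H2]; apply H2, H1; lia. }
    destruct (ultra_ex_lt p Hp (K i) (fun j x => (i <= j)%nat /\ A j x)) as [j [_ Hj]].
    { apply (ultra_sub p Hp _ _ HU); intros x [j [Hj HAj]]; exists j; repeat split; tauto || lia. }
    exists j; split.
    * destruct (ultra_ex p Hp _ Hj) as [x [Hx _]]; exact Hx.
    * apply (ultra_sub p Hp _ _ Hj); tauto.
Qed.

Lemma lim_seq_eps (u : nat -> R) (l : R) :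
  is_lim_seq u l <-> forall e, 0 < e -> eventually (fun n => Rabs (u n - l) < e).
Proof.
split; intros H.
- intros e He; exact (proj2 (is_lim_seq_spec u l) H (mkposreal e He)).
- apply is_lim_seq_spec; intros e; apply H, cond_pos.
Qed.

(** Compactness and continuity replace countable additivity. If the claim fails, the sets where
    [u (s j)] has modulus at least [d] have measure bounded below, and [intersectivity] puts
    infinitely many of them in one ultrafilter [p]. Along [p] the point [x] converges to some [L] in
    [0,1], and continuity at [L] keeps [u (s j) L] away from 0 for these [j], against pointwise
    convergence. *)
Lemma bounded_convergence (M : (R -> R) -> R) (u : nat -> R -> R) (B : R) :
  is_mean M -> M (fun x => ind (~ 0 <= x <= 1)) = 0 ->
  (forall n, continuity (u n)) -> (forall n x, Rabs (u n x) <= B) ->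
  (forall x, 0 <= x <= 1 -> is_lim_seq (fun n => u n x) 0) ->
  forall e, 0 < e -> eventually (fun n => Rabs (M (u n)) < e).
Proof.
intros HM Hsupp Hcont HB Hlim e He; apply NNPP; intros Hn.
assert (Hinf : forall N, exists n, (N < n)%nat /\ e <= Rabs (M (u n))).
{ intros N; apply NNPP; intros Hc; apply Hn; exists (S N); intros n Hlt.
  apply Rnot_le_lt; intros Hle; apply Hc; exists n; split; [lia | exact Hle]. }
destruct (increasing_selection (fun _ n => e <= Rabs (M (u n)))) as [s [Hs Hes]].
{ intros _ N; apply Hinf. }
assert (Hbu : forall n, bdd (u n)) by (intros n; exists B; apply HB).
set (m := M (fun _ => 1)).
assert (Hm : 0 <= m) by (apply (mean_nonneg M HM); [apply bdd_const | intros; lra]).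
(* The part where the modulus is below [d] contributes at most [d * m <= e / 2]; the other [e / 2]
   must come from [A j]. *)
set (d := e / (2 * (m + 1))).
assert (Hd : 0 < d) by (apply Rdiv_lt_0_compat; lra).
assert (HB0 : 0 <= B) by (apply Rle_trans with (2 := HB 0%nat 0); apply Rabs_pos).
set (A := fun j x => 0 <= x <= 1 /\ d <= Rabs (u (s j) x)).
destruct (intersectivity M A (e / (2 * (B + 1)))) as [p [Hp [Hpos Hio]]].
- exact HM.
- apply Rdiv_lt_0_compat; lra.
- intros j; specialize (Hes j).
  assert (H1 : forall sg, Rabs sg = 1 ->
    sg * M (u (s j)) <= d * m + (B * M (fun x => ind (A j x)) + B * M (fun x => ind (~ 0 <= x <= 1)))).
  { intros sg Hsg; unfold m; rewrite <- !(mean_scal M HM) by (apply bdd_ind || apply bdd_const || auto).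
    rewrite <- (mean_plus M HM) by (apply bdd_mult; [apply bdd_const | apply bdd_ind]).
    assert (Hb : bdd (fun x => B * ind (A j x) + B * ind (~ 0 <= x <= 1)))
      by (apply bdd_plus; apply bdd_mult; apply bdd_const || apply bdd_ind).
    rewrite <- (mean_plus M HM) by (exact Hb || apply bdd_const).
    apply (mean_le M HM);
      [apply bdd_mult; [apply bdd_const | apply Hbu] |
       apply bdd_plus; [apply bdd_const | exact Hb] |].
    intros x; apply Rle_trans with (Rabs (u (s j) x)).
    { apply Rle_trans with (1 := Rle_abs _); rewrite Rabs_mult, Hsg; lra. }
    specialize (HB (s j) x); ind_cases; unfold A in *; lra. }
  assert (H2 : e <= d * m + B * M (fun x => ind (A j x))).
  { apply Rle_trans with (1 := Hes); rewrite Hsupp in H1.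
    pose proof (H1 1 ltac:(apply Rabs_R1)).
    pose proof (H1 (-1) ltac:(rewrite Rabs_left; lra)).
    apply Rabs_le; lra. }
  assert (H3 : d * m <= e / 2).
  { unfold d; apply (Rmult_le_reg_r (2 * (m + 1))); [lra |].
    replace (e / (2 * (m + 1)) * m * (2 * (m + 1))) with (e * m) by (field; lra).
    apply Rle_trans with (e * (m + 1)); [apply Rmult_le_compat_l |]; lra. }
  assert (H4 : 0 <= M (fun x => ind (A j x))) by apply (mean_ind_bounds M HM).
  apply (Rmult_le_reg_r (2 * (B + 1))); [lra |].
  replace (e / (2 * (B + 1)) * (2 * (B + 1))) with e by (field; lra); lra.
(* Clamping makes the identity bounded and changes nothing on the sets [A j]. *)
- destruct (is_ulimit_ex p Hp (fun x => Rmax 0 (Rmin x 1))) as [L HL].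
  { exists 1; intros x; apply Rabs_le; unfold Rmax, Rmin.
    destruct (Rle_dec x 1), (Rle_dec 0 _); lra. }
  assert (HL01 : 0 <= L <= 1).
  { split.
    - apply (is_ulimit_le p Hp (fun _ => 0) _ _ _ (is_ulimit_const p Hp 0) HL), (ultra_all p Hp).
      intros x; apply Rmax_l.
    - apply (is_ulimit_le p Hp _ (fun _ => 1) _ _ HL (is_ulimit_const p Hp 1)), (ultra_all p Hp).
      intros x; apply Rmax_lub; [lra | apply Rmin_r]. }
  destruct (proj1 (lim_seq_eps _ _) (Hlim L HL01) (d / 2) ltac:(lra)) as [N HN].
  destruct (Hio N) as [j [Hj HAj]].
  pose proof (increasing_ge_id s Hs j).
  specialize (HN (s j) ltac:(lia)); rewrite Rminus_0_r in HN.
  destruct (Hcont (s j) L (d / 2) ltac:(lra)) as [al [Hal Hc]].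
  destruct (ultra_ex p Hp _ (ultra_and p Hp _ _ HAj (HL al Hal))) as [x [[Hx1 Hx2] Hx3]].
  rewrite Rmin_left, Rmax_right in Hx3 by lra.
  (* [continuity] speaks only of points other than [L]; for [x = L] the lower bound [d] and the
     upper bound [d / 2] clash at once. *)
  destruct (Req_dec x L) as [->|Hne]; [lra |].
  assert (Hdist : R_dist (u (s j) x) (u (s j) L) < d / 2).
  { apply Hc; repeat split; [| exact Hx3]; intros Heq; apply Hne; congruence. }
  unfold R_dist in Hdist.
  pose proof (Rabs_triang (u (s j) x - u (s j) L) (u (s j) L)) as Ht.
  replace (u (s j) x - u (s j) L + u (s j) L) with (u (s j) x) in Ht by ring; lra.
Qed.

(** Positivity bounds [M N f] by [K] times a bound of [f], so the limit along [U] exists, and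
    linearity and positivity pass to it. *)
Lemma ulimit_of_means {X : Type} (U : (nat -> Prop) -> Prop) (M : nat -> (X -> R) -> R) (K : R) :
  is_ultra U -> (forall N, is_mean (M N)) -> (forall N, M N (fun _ => 1) <= K) ->
  is_mean (fun f => ulimit U (fun N => M N f)) /\
  forall f, bdd f -> is_ulimit U (fun N => M N f) (ulimit U (fun N => M N f)).
Proof.
intros HU HM HK.
assert (Hlim : forall f, bdd f -> is_ulimit U (fun N => M N f) (ulimit U (fun N => M N f))).
{ intros f Hf; destruct (bdd_pos f Hf) as [B [HB0 HB]].
  apply (ulimit_correct U HU); exists (B * K); intros N.
  assert (Hn1 : bdd (fun _ : X => 1)) by apply bdd_const.
  apply Rle_trans with (B * M N (fun _ => 1)); [| apply Rmult_le_compat_l; [lra | apply HK]].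
  rewrite <- (mean_const (M N) (HM N) B).
  assert (- B * M N (fun _ => 1) <= M N f).
  { rewrite <- (mean_const (M N) (HM N)); apply (mean_le _ (HM N)); [apply bdd_const | exact Hf |].
    intros x; specialize (HB x); apply Rabs_le_between in HB; lra. }
  assert (M N f <= M N (fun _ => B)).
  { apply (mean_le _ (HM N)); [exact Hf | apply bdd_const |].
    intros x; specialize (HB x); apply Rabs_le_between in HB; lra. }
  rewrite (mean_const (M N) (HM N) B) in *; apply Rabs_le; lra. }
split; [| exact Hlim]; split.
- intros f g Hf Hg; apply (ulimit_eq U HU).
  apply (is_ulimit_ext U HU) with (fun N => M N f + M N g).
  + apply (ultra_all U HU); intros N; rewrite (mean_plus _ (HM N)) by assumption; reflexivity.
  + apply (is_ulimit_plus U HU); apply Hlim; assumption.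
- intros c f Hf; apply (ulimit_eq U HU).
  apply (is_ulimit_ext U HU) with (fun N => c * M N f).
  + apply (ultra_all U HU); intros N; rewrite (mean_scal _ (HM N)) by assumption; reflexivity.
  + apply (is_ulimit_scal U HU); apply Hlim; assumption.
- intros f Hf Hpos.
  apply (is_ulimit_le U HU (fun _ => 0) _ _ _ (is_ulimit_const U HU 0) (Hlim f Hf)).
  apply (ultra_all U HU); intros N; apply (mean_nonneg _ (HM N)); assumption.
Qed.

Lemma avgR_is_mean (l : list nat) : is_mean (avgR l).
Proof.
split.
- intros f g _ _; apply avgR_plus.
- intros c f _; apply avgR_scal.
- intros f _ H; apply avgR_nonneg; auto.
Qed.

(** * Autocorrelations as Fourier transforms *)

(** The Dirichlet kernel: [2 * sin a * cos b] is [sin (b + a) - sin (b - a)], and consecutive terms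
    cancel. *)
Lemma cos_sum_telescope (t : R) (n : nat) :
  2 * sin (PI * t) * sumR (seq 0 n) (fun j => cos (2 * PI * t * INR j))
  = sin (PI * t * (2 * INR n - 1)) + sin (PI * t).
Proof.
induction n as [|n IH].
- unfold sumR; simpl.
  replace (PI * t * (2 * 0 - 1)) with (- (PI * t)) by ring; rewrite sin_neg; ring.
- rewrite seq_S, sumR_app, Rmult_plus_distr_l, IH, sumR_cons, S_INR.
  replace (PI * t * (2 * INR n - 1)) with (2 * PI * t * INR n - PI * t) by ring.
  replace (PI * t * (2 * (INR n + 1) - 1)) with (2 * PI * t * INR n + PI * t) by ring.
  rewrite sin_minus, sin_plus; unfold sumR; simpl; ring.
Qed.

Lemma cos_sum_orthogonal (Q a b : nat) : (a < Q)%nat -> (b < Q)%nat ->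
  sumR (seq 0 Q) (fun j => cos (2 * PI * (INR a - INR b) * (INR j / INR Q))) = INR Q * ind (a = b).
Proof.
assert (Hlt : forall k, (0 < k < Q)%nat ->
  sumR (seq 0 Q) (fun j => cos (2 * PI * INR k * (INR j / INR Q))) = 0).
{ intros k Hk.
  assert (HQ : 0 < INR Q) by (apply lt_0_INR; lia).
  assert (Hk0 : 0 < INR k) by (apply lt_0_INR; lia).
  assert (HkQ : INR k < INR Q) by (apply lt_INR; lia).
  (* At [t = k / Q] the right side vanishes by periodicity, while [sin (PI * t)] is positive as
     [0 < t < 1]. *)
  pose proof (cos_sum_telescope (INR k / INR Q) Q) as H.
  replace (PI * (INR k / INR Q) * (2 * INR Q - 1))
    with (- (PI * (INR k / INR Q)) + 2 * INR k * PI) in H by (field; lra).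
  rewrite sin_period, sin_neg in H.
  assert (Hs : 0 < sin (PI * (INR k / INR Q))).
  { pose proof PI_RGT_0.
    assert (0 < INR k / INR Q < 1).
    { split; [apply Rdiv_lt_0_compat; lra |].
      apply (Rmult_lt_reg_r (INR Q)); [lra |]; unfold Rdiv; rewrite Rmult_assoc, Rinv_l; lra. }
    apply sin_gt_0; [apply Rmult_lt_0_compat; lra |].
    rewrite <- (Rmult_1_r PI) at 2; apply Rmult_lt_compat_l; lra. }
  rewrite (sumR_ext _ _ (fun j => cos (2 * PI * (INR k / INR Q) * INR j))).
  - nra.
  - intros j _; f_equal; field; lra. }
intros Ha Hb; destruct (ind_spec (a = b)) as [[Hab ->]|[Hab ->]].
- subst; rewrite (sumR_ext _ _ (fun _ => 1)).
  + rewrite sumR_const, length_seq; reflexivity.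
  + intros j _; replace (2 * PI * (INR b - INR b) * (INR j / INR Q)) with 0 by ring; apply cos_0.
- rewrite Rmult_0_r; destruct (Nat.lt_total a b) as [Hl|[Hl|Hl]]; [| contradiction |].
  + rewrite <- (Hlt (b - a)%nat) by lia; apply sumR_ext; intros j _.
    rewrite minus_INR by lia; rewrite <- cos_neg; f_equal; ring.
  + rewrite <- (Hlt (a - b)%nat) by lia; apply sumR_ext; intros j _.
    rewrite minus_INR by lia; reflexivity.
Qed.

(** The periodogram of [b] on [l] at frequency [j / Q]: the normalised squared modulus of a Fourier
    sum, in real form. *)
Definition spectral_weight (l : list nat) (Q : nat) (b : nat -> R) (j : nat) : R :=
  ((sumR l (fun x => b x * cos (2 * PI * INR x * (INR j / INR Q)))) ^ 2
   + (sumR l (fun x => b x * sin (2 * PI * INR x * (INR j / INR Q)))) ^ 2)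
  * / (INR Q * INR (length l)).

Definition spectral (l : list nat) (Q : nat) (b : nat -> R) (g : R -> R) : R :=
  sumR (seq 0 Q) (fun j => spectral_weight l Q b j * g (INR j / INR Q)).

Lemma spectral_is_mean l Q b : is_mean (spectral l Q b).
Proof.
unfold spectral; split.
- intros f g _ _; rewrite <- sumR_plus; apply sumR_ext; intros; ring.
- intros c f _; rewrite <- sumR_scal; apply sumR_ext; intros; ring.
- intros f _ Hf.
  replace 0 with (sumR (seq 0 Q) (fun _ => 0)) by (rewrite sumR_const; ring).
  apply sumR_le; intros j _; apply Rmult_le_pos; [| apply Hf].
  unfold spectral_weight; apply Rmult_le_pos.
  + apply Rplus_le_le_0_compat; apply pow2_ge_0.
  + rewrite Rinv_mult; apply Rmult_le_pos; [| apply inv_length_pos].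
    rewrite <- (length_seq Q 0); apply inv_length_pos.
Qed.

Lemma sumR_prod l f g : sumR l f * sumR l g = sumR l (fun x => sumR l (fun y => f x * g y)).
Proof.
rewrite Rmult_comm, <- sumR_scal; apply sumR_ext; intros x _; rewrite sumR_scal; ring.
Qed.

Lemma sumR_single l f a : NoDup l -> sumR l (fun y => f y * ind (a = y)) = ind (In a l) * f a.
Proof.
induction 1 as [|y l Hy Hl IH].
- change (0 = ind False * f a); destruct (ind_spec False) as [[[] _]|[_ ->]]; ring.
- rewrite sumR_cons, IH.
  destruct (ind_spec (a = y)) as [[-> ->]|[Hne ->]].
  + destruct (ind_spec (In y l)) as [[? _]|[_ ->]]; [contradiction |].
    destruct (ind_spec (In y (y :: l))) as [[_ ->]|[Hn _]]; [ring |].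
    exfalso; apply Hn; left; reflexivity.
  + destruct (ind_spec (In a l)) as [[Hi ->]|[Hi ->]];
    destruct (ind_spec (In a (y :: l))) as [[Hj ->]|[Hj ->]]; try ring; exfalso.
    * apply Hj; right; exact Hi.
    * destruct Hj as [Hj|Hj]; [apply Hne; auto | auto].
Qed.

(** A finite Wiener-Khinchin identity. After expanding the squares, orthogonality over the multiples
    of [1 / Q] leaves only the pairs with [y = x + z] or [x = y + z], which give equal sums. Since
    [x + z < Q] on [l], nothing wraps around modulo [Q]. *)
Lemma spectral_cos l Q b z : NoDup l -> (forall x, In x l -> (x + z < Q)%nat) ->
  spectral l Q b (fun th => cos (2 * PI * INR z * th))
  = avgR l (fun x => b x * (ind (In (x + z)%nat l) * b (x + z)%nat)).
Proof.
intros Hl HQ.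
(* For the empty list both sides are 0, because [/ 0 = 0]. *)
destruct l as [|a0 l0].
{ unfold spectral, avgR, spectral_weight, sumR at 4; simpl.
  rewrite Rmult_0_r, Rinv_0; unfold Rdiv; rewrite Rmult_0_l.
  rewrite (sumR_ext _ _ (fun _ => 0)) by (intros; ring); rewrite sumR_const; ring. }
set (l := a0 :: l0) in *.
assert (HQ0 : INR Q <> 0) by (apply not_0_INR; specialize (HQ a0 (or_introl eq_refl)); lia).
assert (Hl0 : INR (length l) <> 0) by (apply not_0_INR; simpl; lia).
(* The squared modulus yields the cosine of the phase difference of [x] and [y]; its product with
   the cosine at [z] splits into the frequencies [x + z - y] and [x - y - z]. *)
assert (Hsq : forall j, spectral_weight l Q b j * cos (2 * PI * INR z * (INR j / INR Q))
  = / (INR Q * INR (length l)) * sumR l (fun x => sumR l (fun y => b x * b y * / 2 *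
     (cos (2 * PI * (INR (x + z) - INR y) * (INR j / INR Q))
      + cos (2 * PI * (INR x - INR (y + z)) * (INR j / INR Q)))))).
{ intros j; unfold spectral_weight; simpl pow; rewrite !Rmult_1_r, !sumR_prod.
  rewrite <- sumR_plus.
  rewrite (Rmult_comm _ (/ _)), Rmult_assoc; f_equal.
  rewrite Rmult_comm, <- sumR_scal; apply sumR_ext; intros x _.
  rewrite <- sumR_plus, <- sumR_scal; apply sumR_ext; intros y _.
  rewrite !plus_INR; set (t := INR j / INR Q).
  replace (2 * PI * (INR x + INR z - INR y) * t)
    with (2 * PI * INR z * t + (2 * PI * INR x * t - 2 * PI * INR y * t)) by ring.
  replace (2 * PI * (INR x - (INR y + INR z)) * t)
    with ((2 * PI * INR x * t - 2 * PI * INR y * t) - 2 * PI * INR z * t) by ring.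
  rewrite cos_plus, (cos_minus (_ - _)), (cos_minus (2 * PI * INR x * t)); field. }
unfold spectral; rewrite (sumR_ext _ _ _ (fun j _ => Hsq j)), sumR_scal, sumR_swap.
rewrite (sumR_ext l _ (fun x => INR Q * / 2 * (sumR l (fun y => b x * b y * ind ((x + z)%nat = y))
                        + sumR l (fun y => b x * b y * ind (x = (y + z)%nat))))).
- rewrite sumR_scal, sumR_plus.
  rewrite (sumR_swap l l (fun x y => b x * b y * ind (x = (y + z)%nat))).
  set (D := sumR l (fun x => b x * (ind (In (x + z)%nat l) * b (x + z)%nat))).
  assert (HD1 : sumR l (fun x => sumR l (fun y => b x * b y * ind ((x + z)%nat = y))) = D).
  { apply sumR_ext; intros x _.
    rewrite <- (sumR_single l b (x + z) Hl), <- sumR_scal; apply sumR_ext; intros; ring. }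
  assert (HD2 : sumR l (fun y => sumR l (fun x => b x * b y * ind (x = (y + z)%nat))) = D).
  { apply sumR_ext; intros x _.
    rewrite <- (sumR_single l b (x + z) Hl), <- sumR_scal; apply sumR_ext; intros y _.
    ind_cases; try ring; exfalso; congruence. }
  rewrite HD1, HD2; unfold avgR; fold D; field; auto.
- intros x Hx; rewrite sumR_swap.
  rewrite <- sumR_plus, <- sumR_scal; apply sumR_ext; intros y Hy.
  rewrite sumR_scal, sumR_plus, !cos_sum_orthogonal.
  + ring.
  + specialize (HQ x Hx); lia.
  + apply HQ; exact Hy.
  + apply HQ; exact Hx.
  + specialize (HQ y Hy); lia.
Qed.

(** * The invariant mean along a Folner sequence *)

Lemma inb_spec l n : inb l n = true <-> In n l.
Proof.
unfold inb; rewrite existsb_exists; split.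
- intros [x [Hx Heq]]; apply Nat.eqb_eq in Heq; subst; exact Hx.
- intros H; exists n; split; [exact H | apply Nat.eqb_refl].
Qed.

Lemma sumR_split l (c : nat -> bool) f :
  sumR l f = sumR (filter c l) f + sumR (filter (fun n => negb (c n)) l) f.
Proof.
rewrite <- !sumR_filter, <- sumR_plus; apply sumR_ext; intros n _.
destruct (c n); simpl; ring.
Qed.

Lemma sumR_abs_le l f B : (forall n, Rabs (f n) <= B) -> Rabs (sumR l f) <= B * INR (length l).
Proof.
intros H; apply Rle_trans with (1 := sumR_abs _ _).
rewrite Rmult_comm, <- sumR_const; apply sumR_le; auto.
Qed.

(** The first sum runs over [l + a]. Its part inside [l] cancels against the part of [l] inside
    [l + a], and [symdiff_shift_card] counts the terms that remain. *)
Lemma sumR_shift l a f B : NoDup l -> (forall n, Rabs (f n) <= B) ->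
  Rabs (sumR l (fun n => f (n + a)%nat) - sumR l f) <= B * INR (symdiff_shift_card l a).
Proof.
intros Hl HB.
set (c := fun n => existsb (fun k => Nat.eqb (k + a) n) l).
assert (Hc : forall n, c n = true <-> exists k, In k l /\ (k + a)%nat = n).
{ intros n; unfold c; rewrite existsb_exists; split; intros [k [Hk He]]; exists k;
  (split; [exact Hk | apply Nat.eqb_eq; exact He]). }
rewrite (sumR_split l (fun n => inb l (n + a)) (fun n => f (n + a)%nat)), (sumR_split l c f).
rewrite <- (sumR_map (fun n => (n + a)%nat) (filter (fun n => inb l (n + a)) l) f).
rewrite (sumR_perm (map _ _) (filter c l)).
- pose proof (sumR_abs_le (filter (fun n => negb (inb l (n + a))) l) (fun n => f (n + a)%nat) B
    (fun n => HB (n + a)%nat)) as H1.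
  pose proof (sumR_abs_le (filter (fun n => negb (c n)) l) f B HB) as H2.
  unfold symdiff_shift_card; fold c; rewrite plus_INR.
  apply Rabs_le_between in H1; apply Rabs_le_between in H2; apply Rabs_le.
  unfold c in *; lra.
- apply NoDup_Permutation.
  + apply FinFun.Injective_map_NoDup; [intros x y; lia | apply NoDup_filter; exact Hl].
  + apply NoDup_filter; exact Hl.
  + intros n; rewrite in_map_iff, filter_In, Hc; split.
    * intros [k [<- Hk]]; apply filter_In in Hk; destruct Hk as [Hk1 Hk2].
      split; [apply inb_spec; exact Hk2 | exists k; auto].
    * intros [Hn [k [Hk He]]]; exists k; split; [exact He |].
      apply filter_In; split; [exact Hk | apply inb_spec; rewrite He; exact Hn].
Qed.

Lemma eventually_and (P Q : nat -> Prop) :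
  eventually P -> eventually Q -> eventually (fun n => P n /\ Q n).
Proof.
intros [N H] [M K]; exists (N + M)%nat; intros n Hn; split; [apply H | apply K]; lia.
Qed.

Lemma eventually_mono (P Q : nat -> Prop) :
  (forall n, P n -> Q n) -> eventually P -> eventually Q.
Proof. intros H [N HN]; exists N; auto. Qed.

Lemma eventually_forall_le (k : nat) (P : nat -> nat -> Prop) :
  (forall i, (i <= k)%nat -> eventually (P i)) ->
  eventually (fun n => forall i, (i <= k)%nat -> P i n).
Proof.
intros H; induction k as [|k IH].
- apply (eventually_mono (P 0%nat)); [| apply H; lia].
  intros n Hn i Hi; assert (i = 0)%nat by lia; subst; exact Hn.
- apply (eventually_mono (fun n => (forall i, (i <= k)%nat -> P i n) /\ P (S k) n)).
  + intros n [H1 H2] i Hi; destruct (Nat.eq_dec i (S k)); [subst; auto | apply H1; lia].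
  + apply eventually_and; [apply IH; intros i Hi; apply H; lia | apply H; lia].
Qed.

Section Folner.
Context (Phi : nat -> list nat) (HPhi : Folner Phi).

Lemma Folner_nonempty N : Phi N <> [].
Proof. exact (proj2 (proj1 HPhi N)). Qed.

Lemma Folner_NoDup N : NoDup (Phi N).
Proof. exact (proj1 (proj1 HPhi N)). Qed.

Lemma Folner_symdiff a e : 0 < e ->
  eventually (fun N => INR (symdiff_shift_card (Phi N) a) / INR (length (Phi N)) < e).
Proof.
intros He; generalize (proj1 (lim_seq_eps _ _) (proj2 HPhi a) e He).
apply eventually_mono; intros N; rewrite Rminus_0_r; apply Rle_lt_trans, Rle_abs.
Qed.

(** The rank is uniform over all [f] bounded by [B], so one instance serves several functions at
    once. *)
Lemma Folner_shift a B e : 0 < e ->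
  eventually (fun N => forall f, (forall n, Rabs (f n) <= B) ->
    Rabs (avgR (Phi N) (fun n => f (n + a)%nat) - avgR (Phi N) f) <= e).
Proof.
intros He.
assert (HB : 0 < Rabs B + 1) by (pose proof (Rabs_pos B); lra).
generalize (Folner_symdiff a (e / (Rabs B + 1)) ltac:(apply Rdiv_lt_0_compat; lra)).
apply eventually_mono; intros N HN f Hf; unfold avgR.
replace (_ - _) with ((sumR (Phi N) (fun n => f (n + a)%nat) - sumR (Phi N) f) * / INR (length (Phi N)))
  by (unfold Rdiv; ring).
rewrite Rabs_mult, (Rabs_pos_eq (/ _)) by apply inv_length_pos.
apply Rle_trans with (B * INR (symdiff_shift_card (Phi N) a) * / INR (length (Phi N))).
- apply Rmult_le_compat_r; [apply inv_length_pos | apply sumR_shift; auto using Folner_NoDup].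
- set (q := INR (symdiff_shift_card (Phi N) a) / INR (length (Phi N))) in HN.
  replace (B * _ * _) with (B * q) by (unfold q, Rdiv; ring).
  assert (Hq : 0 <= q) by (apply Rmult_le_pos; [apply pos_INR | apply inv_length_pos]).
  apply Rle_trans with ((Rabs B + 1) * q).
  + apply Rmult_le_compat_r; [exact Hq | pose proof (Rle_abs B); lra].
  + apply Rle_trans with ((Rabs B + 1) * (e / (Rabs B + 1))); [| right; field; lra].
    apply Rmult_le_compat_l; lra.
Qed.

Context (U : (nat -> Prop) -> Prop) (HU : is_ultra U) (Hfree : forall A, eventually A -> U A).

Definition fmean (f : nat -> R) : R := ulimit U (fun N => avgR (Phi N) f).

Lemma fmean_spec : is_mean fmean /\
  forall f, bdd f -> is_ulimit U (fun N => avgR (Phi N) f) (fmean f).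
Proof.
apply (ulimit_of_means U (fun N => avgR (Phi N)) 1 HU).
- intros N; apply avgR_is_mean.
- intros N; rewrite avgR_const; [lra | apply Folner_nonempty].
Qed.

Lemma fmean_mean : is_mean fmean.
Proof. exact (proj1 fmean_spec). Qed.

Lemma fmean_ulimit f : bdd f -> is_ulimit U (fun N => avgR (Phi N) f) (fmean f).
Proof. exact (proj2 fmean_spec f). Qed.

Lemma fmean_1 : fmean (fun _ => 1) = 1.
Proof.
apply (ulimit_eq U HU), (is_ulimit_ext U HU) with (fun _ => 1).
- apply (ultra_all U HU); intros N; rewrite avgR_const; [reflexivity | apply Folner_nonempty].
- apply (is_ulimit_const U HU).
Qed.

Lemma fmean_le_eventually f c : bdd f ->
  eventually (fun N => avgR (Phi N) f <= c) -> fmean f <= c.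
Proof.
intros Hf H; apply (is_ulimit_le U HU _ _ _ _ (fmean_ulimit f Hf) (is_ulimit_const U HU c)).
apply Hfree; exact H.
Qed.

Lemma fmean_shift a f : bdd f -> fmean (fun n => f (n + a)%nat) = fmean f.
Proof.
intros [B HB]; apply (ulimit_eq U HU).
intros e He.
assert (Hf : bdd f) by (exists B; exact HB).
pose proof (Hfree _ (Folner_shift a B (e / 2) ltac:(lra))) as H1.
pose proof (fmean_ulimit f Hf (e / 2) ltac:(lra)) as H2.
apply (ultra_sub U HU _ _ (ultra_and U HU _ _ H1 H2)); intros N [K1 K2].
specialize (K1 f HB).
pose proof (Rabs_triang (avgR (Phi N) (fun n => f (n + a)%nat) - avgR (Phi N) f)
  (avgR (Phi N) f - fmean f)) as Ht.
replace (_ + _) with (avgR (Phi N) (fun n => f (n + a)%nat) - fmean f) in Ht by ring; lra.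
Qed.

Lemma list_max_In (l : list nat) x : In x l -> (x <= list_max l)%nat.
Proof.
intros H; pose proof (proj1 (list_max_le l (list_max l)) (Nat.le_refl _)) as HF.
rewrite Forall_forall in HF; exact (HF x H).
Qed.

(** A finitely additive Herglotz theorem: the measure is the limit along [U] of the periodograms of
    [b] on [Phi N]. Cosine coefficients suffice because [b] is real. *)
Lemma autocorrelation_spectral_mean (b : nat -> R) : (forall n, Rabs (b n) <= 1) ->
  exists M : (R -> R) -> R, is_mean M /\ M (fun x => ind (~ 0 <= x <= 1)) = 0 /\
    forall z, M (fun th => cos (2 * PI * INR z * th)) = fmean (fun x => b x * b (x + z)%nat).
Proof.
intros Hb.
(* Large enough that, for every fixed [z], nothing wraps around modulo [Q N] once [N >= z]. *)
set (Q := fun N => S (list_max (Phi N) + N)).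
assert (HQ : forall N z x, (z <= N)%nat -> In x (Phi N) -> (x + z < Q N)%nat).
{ intros N z x Hz Hx; apply list_max_In in Hx; unfold Q; lia. }
destruct (ulimit_of_means U (fun N => spectral (Phi N) (Q N) b) 1 HU) as [HM Hlim].
- intros N; apply spectral_is_mean.
- intros N.
  (* The total mass is the coefficient at [z = 0], an average of squares of values of [b]. *)
  replace (spectral (Phi N) (Q N) b (fun _ => 1))
    with (spectral (Phi N) (Q N) b (fun th => cos (2 * PI * INR 0 * th))).
  + rewrite spectral_cos; [| apply Folner_NoDup | intros; apply HQ; auto; lia].
    rewrite <- (avgR_const (Phi N) 1) by apply Folner_nonempty.
    apply avgR_le; intros x _; rewrite Nat.add_0_r.
    pose proof (proj1 (Rabs_le_between _ _) (Hb x)).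
    ind_cases; nra.
  + apply sumR_ext; intros j _; do 2 f_equal.
    simpl; rewrite Rmult_0_r, Rmult_0_l; apply cos_0.
- eexists; split; [exact HM | split].
  + apply (ulimit_eq U HU), (is_ulimit_ext U HU) with (fun _ => 0); [| apply (is_ulimit_const U HU)].
    apply (ultra_all U HU); intros N; unfold spectral.
    rewrite (sumR_ext _ _ (fun _ => 0)); [rewrite sumR_const; ring |].
    intros j Hj; apply in_seq in Hj.
    assert (HQ0 : 0 < INR (Q N)) by (apply lt_0_INR; lia).
    assert (Hj2 : INR j < INR (Q N)) by (apply lt_INR; lia).
    pose proof (pos_INR j).
    destruct (ind_spec (~ 0 <= INR j / INR (Q N) <= 1)) as [[Hn ->]|[_ ->]]; [| ring].
    exfalso; apply Hn; split.
    * apply Rmult_le_pos; [lra | left; apply Rinv_0_lt_compat; lra].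
    * apply (Rmult_le_reg_r (INR (Q N))); [lra |]; unfold Rdiv; rewrite Rmult_assoc, Rinv_l; lra.
  + intros z; apply (ulimit_eq U HU).
    assert (Hbb : bdd (fun x => b x * b (x + z)%nat)).
    { apply bdd_mult; exists 1; intros; apply Hb. }
    intros e He.
    pose proof (Hfree _ (Folner_symdiff z (e / 2) ltac:(lra))) as H1.
    pose proof (fmean_ulimit _ Hbb (e / 2) ltac:(lra)) as H2.
    assert (H3 : U (fun N => (z <= N)%nat)) by (apply Hfree; exists z; auto).
    apply (ultra_sub U HU _ _ (ultra_and U HU _ _ H1 (ultra_and U HU _ _ H2 H3))).
    intros N [K1 [K2 K3]].
    rewrite spectral_cos; [| apply Folner_NoDup | intros; apply HQ; auto].
    (* The periodogram only sees those [x] for which [x + z] is still in [Phi N]; the others belong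
       to the symmetric difference, which is negligible. *)
    assert (K4 : Rabs (avgR (Phi N) (fun x => b x * (ind (In (x + z)%nat (Phi N)) * b (x + z)%nat))
                 - avgR (Phi N) (fun x => b x * b (x + z)%nat)) < e / 2).
    { apply Rle_lt_trans with (2 := K1).
      replace (_ - _) with (avgR (Phi N) (fun x => b x * (ind (In (x + z)%nat (Phi N)) * b (x + z)%nat)
        + -1 * (b x * b (x + z)%nat))) by (rewrite avgR_plus, avgR_scal; ring).
      apply Rle_trans with (1 := avgR_abs _ _).
      apply Rle_trans with (avgR (Phi N) (fun x =>
        (if negb (inb (Phi N) (x + z)) then 1 else 0) * 1)).
      - apply avgR_le; intros x _.
        destruct (ind_spec (In (x + z)%nat (Phi N))) as [[Hi ->]|[Hi ->]].
        + rewrite (proj2 (inb_spec _ _) Hi); simpl; apply Rabs_le; lra.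
        + destruct (inb (Phi N) (x + z)) eqn:Heq; [apply inb_spec in Heq; contradiction |].
          simpl; replace (_ + _) with (- (b x * b (x + z)%nat)) by ring.
          rewrite Rabs_Ropp, Rabs_mult.
          apply Rmult_le_compat; auto using Rabs_pos.
      - unfold avgR, Rdiv; apply Rmult_le_compat_r; [apply inv_length_pos |].
        rewrite sumR_filter, sumR_const, Rmult_1_r; apply le_INR.
        unfold symdiff_shift_card; lia. }
    apply Rabs_def2 in K2; apply Rabs_def2 in K4; apply Rabs_def1; lra.
Qed.

(** * Orthogonality of autocorrelations to [in_Bes_perp] *)

Lemma sumC_fst l f : fst (sumC l f) = sumR l (fun n => fst (f n)).
Proof.
induction l as [|a l IH]; [reflexivity |].
change (fst (f a) + fst (sumC l f) = fst (f a) + sumR l (fun n => fst (f n))).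
rewrite IH; reflexivity.
Qed.

Lemma sumC_snd l f : snd (sumC l f) = sumR l (fun n => snd (f n)).
Proof.
induction l as [|a l IH]; [reflexivity |].
change (snd (f a) + snd (sumC l f) = snd (f a) + sumR l (fun n => snd (f n))).
rewrite IH; reflexivity.
Qed.

(** The real and imaginary parts of the defining limits, extended by periodicity to [th = 1]:
    [bounded_convergence] requires a closed interval. *)
Lemma Bes_perp_cos_sin f th : in_Bes_perp Phi f -> 0 <= th <= 1 ->
  is_lim_seq (fun N => avgR (Phi N) (fun n => f n * cos (2 * PI * INR n * th))) 0 /\
  is_lim_seq (fun N => avgR (Phi N) (fun n => f n * sin (2 * PI * INR n * th))) 0.
Proof.
intros [_ Hf] Hth.
assert (Hmain : forall th, 0 <= th < 1 ->
  is_lim_seq (fun N => avgR (Phi N) (fun n => f n * cos (2 * PI * INR n * th))) 0 /\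
  is_lim_seq (fun N => avgR (Phi N) (fun n => f n * sin (2 * PI * INR n * th))) 0).
{ clear th Hth; intros th Hth; specialize (Hf th Hth).
  assert (Hev : forall e, 0 < e -> eventually (fun N =>
    Rabs (avgR (Phi N) (fun n => f n * cos (2 * PI * INR n * th)) - 0) < e /\
    Rabs (avgR (Phi N) (fun n => f n * sin (2 * PI * INR n * th)) - 0) < e)).
  { intros e He.
    assert (Hb : locally (RtoC 0) (fun z : C => Rabs (fst z - 0) < e /\ Rabs (snd z - 0) < e)).
    { exists (mkposreal e He); intros z [Hz1 Hz2]; split; [exact Hz1 | exact Hz2]. }
    generalize (Hf _ Hb); apply eventually_mono; intros N [H1 H2].
    assert (Hr : forall z r, fst (Cmult z (RtoC r)) = fst z * r /\ snd (Cmult z (RtoC r)) = snd z * r)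
      by (intros z r; unfold Cmult, RtoC; simpl; split; ring).
    unfold avgC in H1, H2.
    rewrite (proj1 (Hr _ _)), sumC_fst in H1; rewrite (proj2 (Hr _ _)), sumC_snd in H2.
    split; [refine (eq_ind _ (fun t => Rabs (t - 0) < e) H1 _ _)
           | refine (eq_ind _ (fun t => Rabs (t - 0) < e) H2 _ _)];
    unfold avgR, Rdiv; f_equal; apply sumR_ext; intros n _; unfold e2pi, Cmult, RtoC; simpl;
    rewrite <- !(Rmult_assoc (2 * PI)); ring. }
  split; apply lim_seq_eps; intros e He; generalize (Hev e He); apply eventually_mono; tauto. }
destruct (Req_dec th 1) as [->|Hne]; [| apply Hmain; lra].
destruct (Hmain 0 ltac:(lra)) as [H1 H2].
split; [revert H1 | revert H2]; apply is_lim_seq_ext; intros N; apply avgR_ext; intros n _; f_equal.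
- replace (2 * PI * INR n * 1) with (0 + 2 * INR n * PI) by ring.
  rewrite cos_period; f_equal; ring.
- replace (2 * PI * INR n * 1) with (0 + 2 * INR n * PI) by ring.
  rewrite sin_period; f_equal; ring.
Qed.

Lemma continuity_sumR (l : list nat) (F : nat -> R -> R) :
  (forall n, continuity (F n)) -> continuity (fun x => sumR l (fun n => F n x)).
Proof.
intros HF; induction l as [|a l IH].
- apply continuity_const; intros x y; reflexivity.
- exact (continuity_plus (F a) _ (HF a) IH).
Qed.

(** The autocorrelation at [m] is the integral of [cos (2 * PI * m * th)] against [M]. Exchanging
    [M] with the finite average over [m] leaves [M (u N)], where [u N] tends to 0 at each frequency
    because [f] is in [in_Bes_perp]; [bounded_convergence] concludes. *)
Lemma autocorrelation_orthogonal (b f : nat -> R) (n : nat) :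
  (forall n, Rabs (b n) <= 1) -> in_Bes_perp Phi f -> bdd f ->
  fmean (fun m => fmean (fun x => b x * b (x + m)%nat) * f (n + m)%nat) = 0.
Proof.
intros Hb Hperp Hf.
destruct (autocorrelation_spectral_mean b Hb) as [M [HM [Hsupp Hcos]]].
destruct (bdd_pos f Hf) as [B [HB0 HB]].
assert (Hcosb : forall z, bdd (fun th => cos (2 * PI * INR z * th))).
{ intros z; exists 1; intros th; apply Rabs_le, COS_bound. }
set (u := fun N th => avgR (Phi N) (fun m => f (n + m)%nat * cos (2 * PI * INR m * th))).
assert (Hu : forall e, 0 < e -> eventually (fun N => Rabs (M (u N)) < e)).
{ apply (bounded_convergence M u B HM Hsupp).
  - intros N; unfold u, avgR.
    apply (continuity_mult (fun th => sumR (Phi N) (fun m => f (n + m)%nat * cos (2 * PI * INR m * th)))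
             (fun _ => / INR (length (Phi N)))).
    + apply (continuity_sumR (Phi N) (fun m th => f (n + m)%nat * cos (2 * PI * INR m * th))); intros m.
      apply (continuity_mult (fun _ => f (n + m)%nat)).
      * apply continuity_const; intros x y; reflexivity.
      * apply (continuity_comp (fun th => 2 * PI * INR m * th) cos); [| apply continuity_cos].
        apply (continuity_mult (fun _ => 2 * PI * INR m) id).
        -- apply continuity_const; intros x y; reflexivity.
        -- apply derivable_continuous, derivable_id.
    + apply continuity_const; intros x y; reflexivity.
  - intros N th; apply avgR_abs_le; [lra |]; intros m; rewrite Rabs_mult.
    rewrite <- (Rmult_1_r B); apply Rmult_le_compat; auto using Rabs_pos.
    apply Rabs_le, COS_bound.
  - intros th Hth; destruct (Bes_perp_cos_sin f th Hperp Hth) as [H1 H2].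
    apply lim_seq_eps; intros e He.
    pose proof (proj1 (lim_seq_eps _ _) H1 (e / 4) ltac:(lra)) as E1.
    pose proof (proj1 (lim_seq_eps _ _) H2 (e / 4) ltac:(lra)) as E2.
    pose proof (Folner_shift n B (e / 5) ltac:(lra)) as E3.
    generalize (eventually_and _ _ E1 (eventually_and _ _ E2 E3)); apply eventually_mono.
    intros N [K1 [K2 K3]]; rewrite Rminus_0_r in *.
    assert (Hbd : forall t m, Rabs t <= 1 -> Rabs (f m * t) <= B).
    { intros t m Ht; rewrite Rabs_mult, <- (Rmult_1_r B); apply Rmult_le_compat; auto using Rabs_pos. }
    pose proof (K3 (fun m => f m * cos (2 * PI * INR m * th))
      ltac:(intros m; apply Hbd, Rabs_le, COS_bound)) as K4.
    pose proof (K3 (fun m => f m * sin (2 * PI * INR m * th))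
      ltac:(intros m; apply Hbd, Rabs_le, SIN_bound)) as K5.
    simpl in K4, K5; unfold u.
    (* Writing the phase at [m] as that at [m + n] minus that at [n] reduces the translate of [f] to
       [f] itself; each of the two averages is then below [e / 4 + e / 5 < e / 2]. *)
    rewrite (avgR_ext _ _ (fun m => cos (2 * PI * INR n * th) *
               (f (m + n)%nat * cos (2 * PI * INR (m + n) * th))
             + sin (2 * PI * INR n * th) * (f (m + n)%nat * sin (2 * PI * INR (m + n) * th)))).
    + rewrite avgR_plus, !avgR_scal.
      set (X := avgR (Phi N) (fun m => f (m + n)%nat * cos (2 * PI * INR (m + n) * th))) in *.
      set (Y := avgR (Phi N) (fun m => f (m + n)%nat * sin (2 * PI * INR (m + n) * th))) in *.
      assert (HX : Rabs X < e / 2).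
      { apply Rabs_def2 in K1; apply Rabs_le_between in K4; apply Rabs_def1; lra. }
      assert (HY : Rabs Y < e / 2).
      { apply Rabs_def2 in K2; apply Rabs_le_between in K5; apply Rabs_def1; lra. }
      apply Rle_lt_trans with (1 := Rabs_triang _ _); rewrite !Rabs_mult.
      assert (Hle : forall t Z, Rabs t <= 1 -> Rabs t * Rabs Z <= Rabs Z).
      { intros t Z Ht; rewrite <- (Rmult_1_l (Rabs Z)) at 2.
        apply Rmult_le_compat_r; [apply Rabs_pos | exact Ht]. }
      pose proof (Hle _ X (Rabs_le _ 1 (COS_bound (2 * PI * INR n * th)))).
      pose proof (Hle _ Y (Rabs_le _ 1 (SIN_bound (2 * PI * INR n * th)))).
      lra.
    + intros m _; rewrite (Nat.add_comm n m), plus_INR.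
      replace (2 * PI * INR m * th) with (2 * PI * (INR m + INR n) * th - 2 * PI * INR n * th) by ring.
      rewrite cos_minus; ring. }
assert (Hhb : bdd (fun m => fmean (fun x => b x * b (x + m)%nat) * f (n + m)%nat)).
{ apply bdd_mult; [| apply (bdd_comp f (fun m => (n + m)%nat)); exact Hf].
  assert (Hn1 : bdd (fun _ : R => 1)) by apply bdd_const.
  exists (M (fun _ => 1)); intros m; rewrite <- Hcos; apply Rabs_le.
  replace (- M (fun _ => 1)) with (M (fun _ => -1)) by (rewrite (mean_const M HM); ring).
  split; apply (mean_le M HM); auto; try apply bdd_const; intros th; apply COS_bound. }
apply (ulimit_eq U HU); intros e He; apply Hfree.
generalize (Hu e He); apply eventually_mono; intros N HN; rewrite Rminus_0_r.
replace (avgR _ _) with (M (u N)); [exact HN |].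
unfold u; rewrite (mean_avgR M HM).
- apply avgR_ext; intros m _; rewrite (mean_scal M HM), Hcos by apply Hcosb; ring.
- intros m; apply bdd_mult; [apply bdd_const | apply Hcosb].
Qed.

End Folner.

(** * Seminorms *)

Lemma LimSup_lt_eventually (u : nat -> R) (l : R) :
  Rbar_lt (LimSup_seq u) (Finite l) -> eventually (fun n => u n < l).
Proof.
unfold LimSup_seq; destruct (ex_LimSup_seq u) as [[r| |] Hr]; simpl; intros H.
- destruct (Hr (mkposreal (l - r) ltac:(lra))) as [_ [N HN]]; simpl in HN.
  exists N; intros n Hn; specialize (HN n Hn); lra.
- contradiction.
- destruct (Hr l) as [N HN]; exists N; exact HN.
Qed.

Lemma LimSup_nonneg_le (u : nat -> R) (k : R) :
  (forall n, 0 <= u n) -> eventually (fun n => u n <= k) ->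
  exists r, LimSup_seq u = Finite r /\ 0 <= r <= k.
Proof.
intros Hu [N HN].
unfold LimSup_seq; destruct (ex_LimSup_seq u) as [[r| |] Hr]; simpl.
- exists r; split; [reflexivity | split].
  + apply Rnot_lt_le; intros Hlt.
    destruct (Hr (mkposreal (- r) ltac:(lra))) as [_ [M HM]]; simpl in HM.
    specialize (HM M (Nat.le_refl M)); specialize (Hu M); lra.
  + apply Rnot_lt_le; intros Hlt.
    destruct (Hr (mkposreal (r - k) ltac:(lra))) as [HM _]; simpl in HM.
    destruct (HM N) as [n [Hn1 Hn2]]; specialize (HN n Hn1); lra.
- destruct (Hr k N) as [n [Hn1 Hn2]]; specialize (HN n Hn1); lra.
- destruct (Hr 0) as [M HM]; specialize (HM M (Nat.le_refl M)); specialize (Hu M); lra.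
Qed.

Lemma avg_sq_nonneg l (g : nat -> C) : 0 <= avgR l (fun n => Cmod (g n) ^ 2).
Proof. apply avgR_nonneg; intros; apply pow2_ge_0. Qed.

Lemma normC_lt_eventually Phi g d : 0 < d -> Rbar_lt (normC Phi g) (Finite d) ->
  eventually (fun N => avgR (Phi N) (fun n => Cmod (g n) ^ 2) < d ^ 2).
Proof.
intros Hd H; apply LimSup_lt_eventually; unfold normC in H.
destruct (LimSup_seq _) as [r| |]; simpl in *; auto.
apply Rnot_le_lt; intros Hle; apply (Rlt_irrefl d).
apply Rle_lt_trans with (2 := H).
apply Rle_trans with (sqrt (d * d)); [rewrite sqrt_square; lra |].
apply sqrt_le_1_alt; lra.
Qed.

(** All later estimates concern averages of squares. The gap [k < d ^ 2] keeps the inequality strict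
    after the upper limit is taken. *)
Lemma normC_lt_intro Phi g d k : 0 < d -> k < d ^ 2 ->
  eventually (fun N => avgR (Phi N) (fun n => Cmod (g n) ^ 2) <= k) ->
  Rbar_lt (normC Phi g) (Finite d).
Proof.
intros Hd Hk H.
destruct (LimSup_nonneg_le _ k (fun N => avg_sq_nonneg (Phi N) g) H) as [r [Hr Hr0]].
unfold normC; rewrite Hr; simpl.
apply Rlt_le_trans with (sqrt (d * d)); [| rewrite sqrt_square; lra].
apply sqrt_lt_1_alt; lra.
Qed.

Lemma normR_lt_eventually Phi g d : 0 < d -> Rbar_lt (normR Phi g) (Finite d) ->
  eventually (fun N => avgR (Phi N) (fun n => g n ^ 2) < d ^ 2).
Proof.
intros Hd H; generalize (normC_lt_eventually _ _ d Hd H); apply eventually_mono; intros N HN.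
rewrite (avgR_ext _ _ (fun n => Cmod (RtoC (g n)) ^ 2)); [exact HN |].
intros n _; rewrite Cmod_R, pow2_abs; reflexivity.
Qed.

Lemma normR_lt_intro Phi g d k : 0 < d -> k < d ^ 2 ->
  eventually (fun N => avgR (Phi N) (fun n => g n ^ 2) <= k) ->
  Rbar_lt (normR Phi g) (Finite d).
Proof.
intros Hd Hk H; apply (normC_lt_intro Phi _ d k Hd Hk).
revert H; apply eventually_mono; intros N HN.
rewrite (avgR_ext _ _ (fun n => g n ^ 2)); [exact HN |].
intros n _; rewrite Cmod_R, pow2_abs; reflexivity.
Qed.

(** * Total boundedness *)

(** Total boundedness, expressed by a finite partition with [D] holding inside each class.
    Partitions are easy to refine jointly, and one of finitely many classes must have positive
    mean. *)
Definition colorable (D : nat -> nat -> Prop) : Prop :=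
  exists (K : nat) (c : nat -> nat), (forall m, (c m < K)%nat) /\
    forall a b, c a = c b -> D a b.

Lemma colorable_mono (D D' : nat -> nat -> Prop) :
  (forall a b, D a b -> D' a b) -> colorable D -> colorable D'.
Proof. intros H [K [c [Hc HD]]]; exists K, c; auto. Qed.

Lemma colorable_and (D D' : nat -> nat -> Prop) :
  colorable D -> colorable D' -> colorable (fun a b => D a b /\ D' a b).
Proof.
intros [K [c [Hc HD]]] [K' [c' [Hc' HD']]].
(* The pair of colours, encoded in base [K']. *)
exists (K * K')%nat, (fun m => c m * K' + c' m)%nat; split.
- intros m; specialize (Hc m); specialize (Hc' m); nia.
- intros a b H; pose proof (Hc' a); pose proof (Hc' b).
  assert (c a = c b) by nia.
  split; [apply HD; assumption | apply HD'; nia].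
Qed.

Lemma colorable_bdd (v : nat -> R) (d : R) : bdd v -> 0 < d ->
  colorable (fun a b => Rabs (v a - v b) < d).
Proof.
intros [B HB] Hd.
assert (Hpos : forall m, 0 <= (v m + B) / d).
{ intros m; apply Rmult_le_pos; [| left; apply Rinv_0_lt_compat; lra].
  specialize (HB m); apply Rabs_le_between in HB; lra. }
assert (Hup : forall m, (0 < up ((v m + B) / d))%Z).
{ intros m; apply lt_IZR; destruct (archimed ((v m + B) / d)); specialize (Hpos m); lra. }
(* The colour is the index of the interval of length [d] containing [v m + B]; [Hup] makes
   [Z.to_nat] injective on these indices. *)
exists (Z.to_nat (up (2 * B / d) + 2)), (fun m => Z.to_nat (up ((v m + B) / d))); split.
- intros m; apply Z2Nat.inj_lt; [specialize (Hup m); lia | |].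
  + assert (0 < up (2 * B / d))%Z; [| lia].
    apply lt_IZR; destruct (archimed (2 * B / d)).
    assert (0 <= 2 * B / d); [| lra].
    apply Rmult_le_pos; [| left; apply Rinv_0_lt_compat; lra].
    specialize (HB m); pose proof (Rabs_pos (v m)); lra.
  + apply lt_IZR; rewrite plus_IZR.
    destruct (archimed ((v m + B) / d)); destruct (archimed (2 * B / d)).
    assert ((v m + B) / d <= 2 * B / d); [| lra].
    apply Rmult_le_compat_r; [left; apply Rinv_0_lt_compat; lra |].
    specialize (HB m); apply Rabs_le_between in HB; lra.
- intros a b Hab.
  apply Z2Nat.inj in Hab; [| specialize (Hup a); lia | specialize (Hup b); lia].
  destruct (archimed ((v a + B) / d)); destruct (archimed ((v b + B) / d)).
  rewrite Hab in *.
  assert (Hq : Rabs ((v a - v b) / d) < 1).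
  { replace ((v a - v b) / d) with ((v a + B) / d - (v b + B) / d) by (field; lra).
    apply Rabs_def1; lra. }
  unfold Rdiv in Hq; rewrite Rabs_mult, (Rabs_pos_eq (/ d)) in Hq
    by (left; apply Rinv_0_lt_compat; lra).
  apply (Rmult_lt_reg_r (/ d)); [apply Rinv_0_lt_compat; lra |].
  rewrite Rinv_r; lra.
Qed.

(** [L] bounds one chosen representative of each nonempty class, by induction on the number of
    colours. Only finitely many shifts then have to be controlled. *)
Lemma colorable_reps (D : nat -> nat -> Prop) : colorable D ->
  exists L, forall m, exists k, (k <= L)%nat /\ D m k.
Proof.
intros [K [c [Hc HD]]].
assert (HL : forall K', exists L, forall m, (c m < K')%nat -> exists k, (k <= L)%nat /\ c m = c k).
{ induction K' as [|K' [L HL]]; [exists 0%nat; intros; lia |].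
  destruct (classic (exists k, c k = K')) as [[k Hk]|Hn].
  - exists (L + k)%nat; intros m Hm; destruct (Nat.eq_dec (c m) K').
    + exists k; split; [lia | congruence].
    + destruct (HL m ltac:(lia)) as [k' [Hk' He]]; exists k'; split; [lia | exact He].
  - exists L; intros m Hm; apply HL.
    assert (c m <> K') by (intros He; apply Hn; exists m; exact He); lia. }
destruct (HL K) as [L H]; exists L; intros m.
destruct (H m (Hc m)) as [k [Hk He]]; exists k; auto.
Qed.

Lemma e2pi_plus s t : e2pi (s + t) = Cmult (e2pi s) (e2pi t).
Proof.
unfold e2pi, Cmult; simpl; rewrite Rmult_plus_distr_l, cos_plus, sin_plus; f_equal; ring.
Qed.

Lemma Cmod_e2pi s : Cmod (e2pi s) = 1.
Proof.
unfold Cmod, e2pi; simpl; rewrite !Rmult_1_r.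
pose proof (sin2_cos2 (2 * PI * s)) as H; unfold Rsqr in H.
rewrite Rplus_comm, H; apply sqrt_1.
Qed.

Lemma Cmod_le_abs (z : C) : Cmod z <= Rabs (fst z) + Rabs (snd z).
Proof.
unfold Cmod; apply Rle_trans with (sqrt ((Rabs (fst z) + Rabs (snd z)) * (Rabs (fst z) + Rabs (snd z)))).
- apply sqrt_le_1_alt; rewrite <- (pow2_abs (fst z)), <- (pow2_abs (snd z)).
  pose proof (Rabs_pos (fst z)); pose proof (Rabs_pos (snd z)); nra.
- rewrite sqrt_square; [lra |].
  pose proof (Rabs_pos (fst z)); pose proof (Rabs_pos (snd z)); lra.
Qed.

(** A termwise bound for the uniform distance between two translates of [trigpoly P] (see
    [tdist_spec]), chosen because it is exactly invariant under shifts. *)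
Definition tdist (P : list (C * R)) (a b : nat) : R :=
  fold_right Rplus 0 (map (fun ct : C * R =>
    Cmod (fst ct) * Cmod (Cminus (e2pi (snd ct * INR a)) (e2pi (snd ct * INR b)))) P).

Lemma tdist_shift P a b x : tdist P (a + x) (b + x) = tdist P a b.
Proof.
unfold tdist; f_equal; apply map_ext; intros [c t]; simpl; f_equal.
rewrite !plus_INR, !Rmult_plus_distr_l, !e2pi_plus.
rewrite <- (Rmult_1_r (Cmod (Cminus (e2pi (t * INR a)) _))), <- (Cmod_e2pi (t * INR x)), <- Cmod_mult.
f_equal; ring.
Qed.

Lemma tdist_nonneg P a b : 0 <= tdist P a b.
Proof.
induction P as [|[c t] P IH]; [right; reflexivity |].
apply Rplus_le_le_0_compat; [apply Rmult_le_pos; apply Cmod_ge_0 | exact IH].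
Qed.

Lemma tdist_triangle P a b c : tdist P a c <= tdist P a b + tdist P b c.
Proof.
induction P as [|[z t] P IH]; [unfold tdist; simpl; lra |].
unfold tdist in *; simpl.
assert (H : Cmod (e2pi (t * INR a) - e2pi (t * INR c))
  <= Cmod (e2pi (t * INR a) - e2pi (t * INR b)) + Cmod (e2pi (t * INR b) - e2pi (t * INR c))).
{ replace (e2pi (t * INR a) - e2pi (t * INR c))%C
    with ((e2pi (t * INR a) - e2pi (t * INR b)) + (e2pi (t * INR b) - e2pi (t * INR c)))%C by ring.
  apply Cmod_triangle. }
apply (Rmult_le_compat_l (Cmod z)) in H; [lra | apply Cmod_ge_0].
Qed.

Lemma tdist_sym P a b : tdist P a b = tdist P b a.
Proof.
unfold tdist; f_equal; apply map_ext; intros [c t]; simpl; f_equal.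
rewrite <- Cmod_opp; f_equal; ring.
Qed.

Lemma tdist_spec P n a b :
  Cmod (Cminus (trigpoly P (n + a)) (trigpoly P (n + b))) <= tdist P a b.
Proof.
induction P as [|[z t] P IH].
- unfold trigpoly, tdist; simpl.
  replace (0 - 0)%C with (RtoC 0) by ring; rewrite Cmod_0; lra.
- unfold trigpoly, tdist in *; simpl.
  match type of IH with Cmod (?x - ?y)%C <= _ => set (X := x) in *; set (Y := y) in * end.
  rewrite !plus_INR, !Rmult_plus_distr_l, !e2pi_plus.
  replace (_ - _)%C with
    ((z * (e2pi (t * INR n) * (e2pi (t * INR a) - e2pi (t * INR b)))) + (X - Y))%C by ring.
  apply Rle_trans with (1 := Cmod_triangle _ _); rewrite !Cmod_mult, Cmod_e2pi; lra.
Qed.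

Lemma trigpoly_bdd P : bdd (fun n => Cmod (trigpoly P n)).
Proof.
exists (fold_right Rplus 0 (map (fun ct : C * R => Cmod (fst ct)) P)); intros n.
rewrite Rabs_pos_eq by apply Cmod_ge_0.
induction P as [|[z t] P IH]; unfold trigpoly in *; simpl.
- rewrite Cmod_0; lra.
- apply Rle_trans with (1 := Cmod_triangle _ _); rewrite Cmod_mult, Cmod_e2pi; lra.
Qed.

Lemma colorable_tdist P d : 0 < d -> colorable (fun a b => tdist P a b < d).
Proof.
revert d; induction P as [|[z t] P IH]; intros d Hd.
- exists 1%nat, (fun _ => 0%nat); split; [lia | intros; exact Hd].
(* Real and imaginary parts each vary by less than [e], so the head term is at most
   [Cmod z * (2 * e) <= d / 2]. *)
- set (e := d / (4 * (Cmod z + 1))).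
  pose proof (Cmod_ge_0 z) as Hz.
  assert (He : 0 < e) by (apply Rdiv_lt_0_compat; lra).
  assert (Hc : bdd (fun m => fst (e2pi (t * INR m)))).
  { exists 1; intros m; apply Rabs_le, COS_bound. }
  assert (Hs : bdd (fun m => snd (e2pi (t * INR m)))).
  { exists 1; intros m; apply Rabs_le, SIN_bound. }
  generalize (colorable_and _ _ (colorable_and _ _ (colorable_bdd _ e Hc He) (colorable_bdd _ e Hs He))
    (IH (d / 2) ltac:(lra))).
  apply colorable_mono; intros a b [[H1 H2] H3].
  unfold tdist in *; simpl fold_right; simpl fst; simpl snd.
  assert (H4 : Cmod (e2pi (t * INR a) - e2pi (t * INR b)) <= 2 * e).
  { apply Rle_trans with (1 := Cmod_le_abs _); simpl in *; unfold Rminus in *; lra. }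
  assert (H5 : Cmod z * (2 * e) <= d / 2).
  { apply Rle_trans with ((Cmod z + 1) * (2 * e)); [apply Rmult_le_compat_r; lra |].
    unfold e; right; field; lra. }
  apply (Rmult_le_compat_l (Cmod z)) in H4; [lra | exact Hz].
Qed.

(** * Balls around 0 for the combined pseudometric *)

Section Near.
Context (Phi : nat -> list nat) (HPhi : Folner Phi).

(** A squared distance, so that the triangle inequality costs a factor 2. With [eventually] in place
    of an upper limit, a shift costs an arbitrarily small loss. *)
Definition qnear (f : nat -> R) (d : R) (a b : nat) : Prop :=
  eventually (fun N => avgR (Phi N) (fun n => (f (n + a)%nat - f (n + b)%nat) ^ 2) <= d).

Lemma qnear_shift f d d' a b x : bdd f -> d < d' ->
  (qnear f d a b -> qnear f d' (a + x) (b + x)) /\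
  (qnear f d (a + x) (b + x) -> qnear f d' a b).
Proof.
intros Hf Hd.
assert (Hg : bdd (fun n => (f (n + a)%nat - f (n + b)%nat) ^ 2)).
{ apply bdd_pow2, bdd_minus; apply (bdd_comp f); exact Hf. }
destruct Hg as [B HB].
pose proof (Folner_shift Phi HPhi x B (d' - d) ltac:(lra)) as HS.
assert (Heq : forall N, avgR (Phi N) (fun n => (f (n + (a + x))%nat - f (n + (b + x))%nat) ^ 2)
  = avgR (Phi N) (fun n => (f (n + x + a)%nat - f (n + x + b)%nat) ^ 2)).
{ intros N; apply avgR_ext; intros n _.
  replace (n + (a + x))%nat with (n + x + a)%nat by lia.
  replace (n + (b + x))%nat with (n + x + b)%nat by lia; reflexivity. }
split; intros H; generalize (eventually_and _ _ H HS); apply eventually_mono; intros N [H1 H2];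
  specialize (H2 _ HB); simpl in H2; apply Rabs_le_between in H2;
  [rewrite Heq | rewrite Heq in H1]; simpl; simpl in H1; lra.
Qed.

Lemma sq_plus_le x y : (x + y) ^ 2 <= 2 * x ^ 2 + 2 * y ^ 2.
Proof. pose proof (pow2_ge_0 (x - y)); simpl in *; lra. Qed.

Lemma qnear_triangle f d d' a b c :
  qnear f d a b -> qnear f d' b c -> qnear f (2 * d + 2 * d') a c.
Proof.
intros H1 H2; generalize (eventually_and _ _ H1 H2); apply eventually_mono; intros N [K1 K2].
apply Rle_trans with (avgR (Phi N) (fun n => 2 * (f (n + a)%nat - f (n + b)%nat) ^ 2
  + 2 * (f (n + b)%nat - f (n + c)%nat) ^ 2)).
- apply avgR_le; intros n _.
  replace (f (n + a)%nat - f (n + c)%nat)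
    with ((f (n + a)%nat - f (n + b)%nat) + (f (n + b)%nat - f (n + c)%nat)) by ring.
  apply sq_plus_le.
- rewrite avgR_plus, !avgR_scal; lra.
Qed.

Lemma qnear_sym f d a b : qnear f d a b -> qnear f d b a.
Proof.
apply eventually_mono; intros N HN.
rewrite (avgR_ext _ _ (fun n => (f (n + a)%nat - f (n + b)%nat) ^ 2)); [exact HN |].
intros n _; ring.
Qed.

Lemma colorable_qnear f d : compact_along Phi f -> 0 < d -> colorable (qnear f d).
Proof.
intros [_ Hf] Hd.
(* The square of this radius is at most [d / 4]. *)
assert (Hmin : 0 < Rmin 1 (d / 4)) by (apply Rmin_pos; lra).
destruct (Hf _ Hmin) as [K HK].
(* Compactness concerns only [m >= 1] and [k >= 1], so 0 receives the colour 0 for itself. *)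
assert (Hk : forall m, exists k, (k <= K)%nat /\ (m = 0%nat <-> k = 0%nat) /\
  (m <> 0%nat -> qnear f (d / 4) m k)).
{ intros [|m]; [exists 0%nat; repeat split; auto; lia |].
  destruct (HK (S m) ltac:(lia)) as [k [Hk1 Hk2]].
  exists k; split; [lia | split; [lia |]]; intros _.
  generalize (normR_lt_eventually _ _ _ Hmin Hk2); apply eventually_mono.
  intros N HN; unfold Rshift in HN; left; apply Rlt_le_trans with (1 := HN).
  pose proof (Rmin_l 1 (d / 4)); pose proof (Rmin_r 1 (d / 4)).
  apply Rle_trans with (1 * Rmin 1 (d / 4)); [simpl; rewrite Rmult_1_r | lra].
  apply Rmult_le_compat_r; lra. }
destruct (choice_fun _ Hk) as [c Hc].
exists (S K), c; split; [intros m; destruct (Hc m); lia |].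
intros a b Hab.
destruct (Hc a) as [_ [Ha0 Ha]]; destruct (Hc b) as [_ [Hb0 Hb]].
destruct (Nat.eq_dec a 0) as [Ea|Ea].
- assert (Eb : b = 0%nat) by (apply Hb0; rewrite <- Hab; apply Ha0; exact Ea); subst.
  exists 0%nat; intros N _; rewrite (avgR_ext _ _ (fun _ => 0)).
  + rewrite avgR_const; [lra | apply (Folner_nonempty Phi HPhi)].
  + intros n _; ring.
- assert (Eb : b <> 0%nat) by (intros Eb; apply Ea, Ha0; rewrite Hab; apply Hb0; exact Eb).
  replace d with (2 * (d / 4) + 2 * (d / 4)) by field.
  apply (qnear_triangle f _ _ a (c a) b); [auto |].
  rewrite Hab; apply qnear_sym; auto.
Qed.

Definition near (f : nat -> R) (P : list (C * R)) (d : R) (a b : nat) : Prop :=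
  qnear f d a b /\ tdist P a b <= d.

Lemma near_triangle f P d d' a b c :
  near f P d a b -> near f P d' b c -> near f P (2 * d + 2 * d') a c.
Proof.
intros [H1 H2] [H3 H4]; split; [apply (qnear_triangle f d d' a b c); assumption |].
pose proof (tdist_triangle P a b c); pose proof (tdist_nonneg P a b); pose proof (tdist_nonneg P b c).
lra.
Qed.

Lemma near_sym f P d a b : near f P d a b -> near f P d b a.
Proof. intros [H1 H2]; split; [apply qnear_sym; exact H1 | rewrite tdist_sym; exact H2]. Qed.

Lemma near_mono f P d d' a b : d <= d' -> near f P d a b -> near f P d' a b.
Proof.
intros Hd [H1 H2]; split; [| lra].
revert H1; apply eventually_mono; intros N HN; lra.
Qed.

Lemma near_shift f P d d' a b x : bdd f -> d < d' ->
  near f P d a b -> near f P d' (a + x) (b + x).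
Proof.
intros Hf Hd [H1 H2]; split; [apply (qnear_shift f d d' a b x Hf Hd); exact H1 |].
rewrite tdist_shift; lra.
Qed.

Lemma near_unshift f P d d' a b x : bdd f -> d < d' ->
  near f P d (a + x) (b + x) -> near f P d' a b.
Proof.
intros Hf Hd [H1 H2]; split; [apply (qnear_shift f d d' a b x Hf Hd); exact H1 |].
rewrite tdist_shift in H2; lra.
Qed.

Lemma colorable_near f P d : compact_along Phi f -> 0 < d -> colorable (near f P d).
Proof.
intros Hf Hd.
generalize (colorable_and _ _ (colorable_qnear f d Hf Hd) (colorable_tdist P d Hd)).
apply colorable_mono; intros a b [H1 H2]; split; [exact H1 | lra].
Qed.

Context (U : (nat -> Prop) -> Prop) (HU : is_ultra U) (Hfree : forall A, eventually A -> U A).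
Notation E := (fmean Phi U).

(** Finitely many classes share the mass 1, so one has positive mean. Shifting it back by one of its
    elements [x] keeps the mean and moves it into the ball around 0. *)
Lemma near_positive_mean f P d : bdd f -> compact_along Phi f -> 0 < d ->
  0 < E (fun m => ind (near f P d m 0)).
Proof.
intros Hb Hf Hd.
pose proof (fmean_mean Phi HPhi U HU) as HM.
destruct (colorable_near f P (d / 2) Hf ltac:(lra)) as [K [c [Hc Hnear]]].
assert (Hi : exists i, 0 < E (fun m => ind (c m = i))).
{ apply NNPP; intros Hn.
  assert (H1 : E (fun _ => 1) <= 0).
  { rewrite (mean_ext _ HM _ (fun m => sumR (seq 0 K) (fun i => ind (c m = i)))).
    - rewrite (proj2 (mean_sumR _ HM (seq 0 K) (fun i m => ind (c m = i)) (fun i => bdd_ind _))).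
      replace 0 with (sumR (seq 0 K) (fun _ => 0)) by (rewrite sumR_const; ring).
      apply sumR_le; intros i _; apply Rnot_lt_le; intros Hlt; apply Hn; exists i; exact Hlt.
    - apply bdd_const.
    - intros m; rewrite (sumR_ext _ _ (fun i => 1 * ind (c m = i))) by (intros; ring).
      rewrite (sumR_single (seq 0 K) (fun _ => 1)) by apply seq_NoDup.
      destruct (ind_spec (In (c m) (seq 0 K))) as [[_ ->]|[Hnot _]]; [ring |].
      exfalso; apply Hnot, in_seq; specialize (Hc m); lia. }
  rewrite (fmean_1 Phi HPhi U HU) in H1; lra. }
destruct Hi as [i Hi].
assert (Hx : exists x, c x = i).
{ apply NNPP; intros Hn.
  rewrite (mean_ext _ HM _ (fun _ => 0)) in Hi.
  - rewrite (mean_const _ HM) in Hi; lra.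
  - apply bdd_ind.
  - intros m; destruct (ind_spec (c m = i)) as [[Hm _]|[_ ->]]; [| reflexivity].
    exfalso; apply Hn; exists m; exact Hm. }
destruct Hx as [x Hx].
apply Rlt_le_trans with (1 := Hi).
rewrite <- (fmean_shift Phi HPhi U HU Hfree x (fun m => ind (c m = i)) (bdd_ind _)).
apply (mean_le _ HM); [apply bdd_ind | apply bdd_ind |].
intros m.
destruct (ind_spec (c (m + x)%nat = i)) as [[Hm ->]|[_ ->]]; [| apply ind_bounds].
destruct (ind_spec (near f P d m 0)) as [[_ ->]|[Hn _]]; [lra |].
exfalso; apply Hn, (near_unshift f P (d / 2) d m 0 x Hb ltac:(lra)).
apply Hnear; rewrite Hm, <- Hx; reflexivity.
Qed.

(* [h] is the autocorrelation of a small ball around [0]: it is supported in a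
   slightly larger ball, and it is the Fourier transform of a positive measure. *)
Lemma near_weight f P d : bdd f -> compact_along Phi f -> 0 < d ->
  exists h : nat -> R, (forall m, 0 <= h m <= 1) /\ (forall m, 0 < h m -> near f P d m 0) /\
    0 < E h /\
    forall g n, in_Bes_perp Phi g -> bdd g -> E (fun m => h m * g (n + m)%nat) = 0.
Proof.
intros Hb Hf Hd.
pose proof (fmean_mean Phi HPhi U HU) as HM.
(* If [x] and [x + m] lie in the ball of radius [12 r], then [m] is within [48 r] of 0 up to the
   loss of a shift, hence within [49 r = d]. If [x] and [m] lie in the ball of radius [2 r], then
   [x + m] lies in that of radius [2 * 4 r + 2 * 2 r = 12 r]. *)
set (r := d / 49).
set (b := fun x => ind (near f P (12 * r) x 0)).
set (be := E (fun m => ind (near f P (2 * r) m 0))).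
assert (Hr : 0 < r) by (unfold r; lra).
assert (Hbe : 0 < be) by (apply near_positive_mean; auto; lra).
assert (Hb1 : forall n, 0 <= b n <= 1) by (intros n; apply ind_bounds).
assert (Hbb : forall m, bdd (fun x => b x * b (x + m)%nat)).
{ intros m; apply bdd_mult; [apply bdd_ind | apply (bdd_comp b (fun x => (x + m)%nat)), bdd_ind]. }
set (h := fun m => E (fun x => b x * b (x + m)%nat)).
assert (Hh : forall m, 0 <= h m <= 1).
{ intros m; split.
  - apply (mean_nonneg _ HM); [apply Hbb |]; intros x; apply Rmult_le_pos; apply Hb1.
  - rewrite <- (fmean_1 Phi HPhi U HU); apply (mean_le _ HM); [apply Hbb | apply bdd_const |].
    intros x; pose proof (Hb1 x); pose proof (Hb1 (x + m)%nat); nra. }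
exists h; split; [exact Hh | split; [| split]].
- intros m Hm.
  assert (Hx : exists x, 0 < b x * b (x + m)%nat).
  { apply NNPP; intros Hn; apply (Rlt_irrefl 0), (Rlt_le_trans _ _ _ Hm).
    apply Rle_trans with (E (fun _ => 0)); [| right; rewrite (mean_const _ HM); ring].
    apply (mean_le _ HM); [apply Hbb | apply bdd_const |].
    intros x; apply Rnot_lt_le; intros Hlt; apply Hn; exists x; exact Hlt. }
  destruct Hx as [x Hx]; unfold b in Hx.
  destruct (ind_spec (near f P (12 * r) x 0)) as [[H1 E1]|[_ E1]]; rewrite E1 in Hx; [| lra].
  destruct (ind_spec (near f P (12 * r) (x + m) 0)) as [[H2 E2]|[_ E2]]; rewrite E2 in Hx; [| lra].
  apply (near_unshift f P (2 * (12 * r) + 2 * (12 * r)) d m 0 x Hb); [unfold r; lra |].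
  rewrite (Nat.add_comm m x); apply (near_triangle f P _ _ _ 0); [exact H2 |].
  apply near_sym; exact H1.
(* [h] is at least [be] on the ball of radius [2 r], which has mean [be]. *)
- apply Rlt_le_trans with (be * be); [apply Rmult_lt_0_compat; exact Hbe |].
  unfold be at 2; rewrite <- (mean_scal _ HM) by apply bdd_ind.
  apply (mean_le _ HM).
  + apply bdd_mult; [apply bdd_const | apply bdd_ind].
  + exists 1; intros m; apply Rabs_le; specialize (Hh m); lra.
  + intros m; destruct (ind_spec (near f P (2 * r) m 0)) as [[Hm ->]|[_ ->]].
    * rewrite Rmult_1_r; apply (mean_le _ HM); [apply bdd_ind | apply Hbb |].
      intros x; destruct (ind_spec (near f P (2 * r) x 0)) as [[Hx ->]|[_ ->]].
      -- unfold b.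
         destruct (ind_spec (near f P (12 * r) x 0)) as [[_ ->]|[Hn _]].
         ++ destruct (ind_spec (near f P (12 * r) (x + m) 0)) as [[_ ->]|[Hn _]]; [lra |].
            exfalso; apply Hn.
            replace (12 * r) with (2 * (4 * r) + 2 * (2 * r)) by ring.
            apply (near_triangle f P _ _ _ (0 + x)); [| exact Hx].
            rewrite (Nat.add_comm x m); apply (near_shift f P (2 * r)); auto; lra.
         ++ exfalso; apply Hn; apply (near_mono f P (2 * r)); [lra | exact Hx].
      -- apply Rmult_le_pos; apply Hb1.
    * rewrite Rmult_0_r; apply Hh.
- intros g n Hg Hgb.
  apply (autocorrelation_orthogonal Phi HPhi U HU Hfree b g n); auto.
  intros x; apply Rabs_le; specialize (Hb1 x); lra.
Qed.

Definition bes_err (f : nat -> R) (P : list (C * R)) (n : nat) : R :=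
  Cmod (Cminus (RtoC (f n)) (trigpoly P n)).

Lemma bes_err_bdd f P : bdd f -> bdd (bes_err f P).
Proof.
intros [A HA]; destruct (trigpoly_bdd P) as [B HB]; exists (A + B); intros n.
unfold bes_err; rewrite Rabs_pos_eq by apply Cmod_ge_0.
apply Rle_trans with (1 := Cmod_triangle _ _).
specialize (HA n); specialize (HB n); rewrite Cmod_opp, Cmod_R.
rewrite Rabs_pos_eq in HB by apply Cmod_ge_0; lra.
Qed.

(* Markov's inequality alone does not give [eta -> 0]; so [f] is approximated better by
   a second trigonometric polynomial, whose difference with the first one has averages
   of its square bounded uniformly in the shift, by total boundedness. *)
Lemma bes_err_shift_average f P e eta : bdd f -> in_Bes Phi f -> 0 < e -> 0 < eta ->
  eventually (fun N => avgR (Phi N) (fun n => bes_err f P n ^ 2) <= e ^ 2) ->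
  eventually (fun N => E (fun m =>
    ind (26 * e ^ 2 < avgR (Phi N) (fun n => bes_err f P (n + m)%nat ^ 2))) <= eta).
Proof.
intros Hf Hbes He Heta Herr.
pose proof (fmean_mean Phi HPhi U HU) as HM.
set (e1 := e * Rmin 1 eta).
assert (Hmin : 0 < Rmin 1 eta) by (apply Rmin_pos; lra).
pose proof (Rmin_l 1 eta) as Hml; pose proof (Rmin_r 1 eta) as Hmr.
assert (He1 : 0 < e1) by (apply Rmult_lt_0_compat; lra).
assert (He2 : 0 < e ^ 2) by (apply pow_lt; lra).
assert (He11 : e1 ^ 2 <= e ^ 2 * eta /\ e1 ^ 2 <= e ^ 2).
{ unfold e1; rewrite Rpow_mult_distr; split.
  - apply Rmult_le_compat_l; [lra |]; nra.
  - rewrite <- (Rmult_1_r (e ^ 2)) at 2; apply Rmult_le_compat_l; [lra |]; nra. }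
destruct (Hbes e1 He1) as [P1 [_ HP1]].
pose proof (normC_lt_eventually _ _ _ He1 HP1) as Herr1.
set (T := fun n => Cmod (Cminus (trigpoly P1 n) (trigpoly P n))).
assert (HTb : bdd (fun n => T n ^ 2)).
{ destruct (trigpoly_bdd P1) as [B1 HB1]; destruct (trigpoly_bdd P) as [B HB].
  apply bdd_pow2; exists (B1 + B); intros n; unfold T; rewrite Rabs_pos_eq by apply Cmod_ge_0.
  apply Rle_trans with (1 := Cmod_triangle _ _); rewrite Cmod_opp.
  specialize (HB1 n); specialize (HB n).
  rewrite Rabs_pos_eq in HB1, HB by apply Cmod_ge_0; lra. }
assert (HT1 : forall n, T n ^ 2 <= 2 * bes_err f P n ^ 2 + 2 * bes_err f P1 n ^ 2).
{ intros n; apply Rle_trans with ((bes_err f P n + bes_err f P1 n) ^ 2); [| apply sq_plus_le].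
  apply pow_incr; split; [apply Cmod_ge_0 |]; unfold T, bes_err.
  replace (trigpoly P1 n - trigpoly P n)%C
    with ((f n - trigpoly P n) + - (f n - trigpoly P1 n))%C by ring.
  apply Rle_trans with (1 := Cmod_triangle _ _); rewrite Cmod_opp; lra. }
assert (HT2 : forall n, bes_err f P n ^ 2 <= 2 * bes_err f P1 n ^ 2 + 2 * T n ^ 2).
{ intros n; apply Rle_trans with ((bes_err f P1 n + T n) ^ 2); [| apply sq_plus_le].
  apply pow_incr; split; [apply Cmod_ge_0 |]; unfold T, bes_err.
  replace (f n - trigpoly P n)%C
    with ((f n - trigpoly P1 n) + (trigpoly P1 n - trigpoly P n))%C by ring.
  apply Cmod_triangle. }
assert (HT3 : forall n a b, T (n + a)%nat <= T (n + b)%nat + (tdist P1 a b + tdist P a b)).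
{ intros n a b; unfold T.
  replace (trigpoly P1 (n + a) - trigpoly P (n + a))%C
    with ((trigpoly P1 (n + b) - trigpoly P (n + b))
      + ((trigpoly P1 (n + a) - trigpoly P1 (n + b))
         + - (trigpoly P (n + a) - trigpoly P (n + b))))%C by ring.
  apply Rle_trans with (1 := Cmod_triangle _ _), Rplus_le_compat_l.
  apply Rle_trans with (1 := Cmod_triangle _ _); rewrite Cmod_opp.
  apply Rplus_le_compat; apply tdist_spec. }
destruct (colorable_reps _ (colorable_and _ _ (colorable_tdist P1 (e / 2) ltac:(lra))
  (colorable_tdist P (e / 2) ltac:(lra)))) as [L HL].
destruct HTb as [B HB].
pose proof (eventually_forall_le L _ (fun k _ => Folner_shift Phi HPhi k B (e ^ 2) He2)) as HS.
generalize (eventually_and _ _ Herr (eventually_and _ _ Herr1 HS)); apply eventually_mono.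
intros N [K1 [K2 K3]].
fold (bes_err f P1) in K2.
(* The mean square of [T] is at most [2 e^2 + 2 e1^2 <= 4 e^2], hence at most [5 e^2] after a shift
   by a representative [k <= L]. Passing from [k] to [m] changes [T] by less than [e], which gives
   [2 * 5 e^2 + 2 e^2]. *)
assert (HTm : forall m, avgR (Phi N) (fun n => T (n + m)%nat ^ 2) <= 12 * e ^ 2).
{ intros m; destruct (HL m) as [k [Hk [H1 H2]]].
  specialize (K3 k Hk _ HB); simpl in K3; apply Rabs_le_between in K3.
  assert (H3 : avgR (Phi N) (fun n => T n ^ 2) <= 2 * e ^ 2 + 2 * e1 ^ 2).
  { apply Rle_trans with (avgR (Phi N) (fun n => 2 * bes_err f P n ^ 2 + 2 * bes_err f P1 n ^ 2)).
    - apply avgR_le; intros; apply HT1.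
    - rewrite avgR_plus, !avgR_scal; unfold bes_err in *; lra. }
  apply Rle_trans with (avgR (Phi N) (fun n => 2 * T (n + k)%nat ^ 2 + 2 * e ^ 2)).
  - apply avgR_le; intros n _.
    apply Rle_trans with ((T (n + k)%nat + e) ^ 2); [| apply sq_plus_le].
    apply pow_incr; split; [apply Cmod_ge_0 |]; specialize (HT3 n m k); lra.
  - rewrite avgR_plus, avgR_scal, avgR_const by apply (Folner_nonempty Phi HPhi).
    simpl in *; lra. }
pose proof (bdd_pow2 _ (bes_err_bdd f P1 Hf)) as Hg1.
pose proof (bdd_pow2 _ (bes_err_bdd f P Hf)) as Hg.
assert (Hg1s : forall n, bdd (fun m => bes_err f P1 (n + m)%nat ^ 2)).
{ intros n; apply (bdd_comp (fun x => bes_err f P1 x ^ 2) (fun m => (n + m)%nat)); exact Hg1. }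
assert (Hmean : E (fun m => avgR (Phi N) (fun n => bes_err f P1 (n + m)%nat ^ 2)) <= e1 ^ 2).
{ rewrite (mean_avgR _ HM (Phi N) (fun n m => bes_err f P1 (n + m)%nat ^ 2) Hg1s).
  rewrite <- (avgR_const (Phi N) (e1 ^ 2)) by apply (Folner_nonempty Phi HPhi).
  apply avgR_le; intros n _.
  rewrite (mean_ext _ HM _ (fun m => bes_err f P1 (m + n)%nat ^ 2));
    [| apply Hg1s | intros m; rewrite Nat.add_comm; reflexivity].
  rewrite (fmean_shift Phi HPhi U HU Hfree n (fun x => bes_err f P1 x ^ 2) Hg1).
  apply (fmean_le_eventually Phi HPhi U HU Hfree _ _ Hg1).
  revert Herr1; apply eventually_mono; intros M HM'; unfold bes_err; lra. }
(* Markov's inequality: an error average above [26 e^2] for [P] forces one above [e^2] for [P1],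
   since [T] accounts for at most [24 e^2]. *)
apply (Rmult_le_reg_l (e ^ 2)); [exact He2 |].
apply Rle_trans with (2 := proj1 He11), Rle_trans with (2 := Hmean).
rewrite <- (mean_scal _ HM) by apply bdd_ind.
destruct Hg1 as [B1 HB1].
apply (mean_le _ HM).
- apply bdd_mult; [apply bdd_const | apply bdd_ind].
- apply (bdd_avgR (fun _ => Phi N) (fun m n => bes_err f P1 (n + m)%nat ^ 2) B1); intros; apply HB1.
- intros m.
  destruct (ind_spec (26 * e ^ 2 < avgR (Phi N) (fun n => bes_err f P (n + m)%nat ^ 2)))
    as [[Hm ->]|[_ ->]].
  + specialize (HTm m).
    assert (avgR (Phi N) (fun n => bes_err f P (n + m)%nat ^ 2)
      <= 2 * avgR (Phi N) (fun n => bes_err f P1 (n + m)%nat ^ 2)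
         + 2 * avgR (Phi N) (fun n => T (n + m)%nat ^ 2)).
    { rewrite <- !avgR_scal, <- avgR_plus; apply avgR_le; intros n _; apply HT2. }
    lra.
  + rewrite Rmult_0_r; apply avgR_nonneg; intros; apply pow2_ge_0.
Qed.

End Near.

(** * Construction of the ultrafilter *)

Lemma weighted_mean {X : Type} (M : (X -> R) -> R) (h : X -> R) :
  is_mean M -> bdd h -> (forall x, 0 <= h x) -> is_mean (fun f => M (fun x => h x * f x)).
Proof.
intros HM Hb Hh; split.
- intros f g Hf Hg; rewrite <- (mean_plus M HM) by (apply bdd_mult; assumption).
  apply (mean_ext M HM); [| intros; ring].
  apply bdd_mult; [exact Hb | apply bdd_plus; assumption].
- intros c f Hf; rewrite <- (mean_scal M HM) by (apply bdd_mult; assumption).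
  apply (mean_ext M HM); [| intros; ring].
  apply bdd_mult; [exact Hb | apply bdd_mult; [apply bdd_const | exact Hf]].
- intros f Hf Hpos; apply (mean_nonneg M HM); [apply bdd_mult; assumption |].
  intros x; apply Rmult_le_pos; auto.
Qed.

(* Otherwise, with [d1] small for [c = M 1 / 2] and then [d2] small for [c] much
   smaller than [d1], some [G N] is at most [-d1] on half of the space and at least
   [-d2] only on a tiny part, so its mean is negative. *)
Lemma uniform_nonnegative_mass {X : Type} (U : (nat -> Prop) -> Prop) (M : (X -> R) -> R)
  (G : nat -> X -> R) (C : R) :
  is_ultra U -> is_mean M -> 0 < M (fun _ => 1) ->
  (forall N x, Rabs (G N x) <= C) -> (forall N, M (G N) = 0) ->
  exists c, 0 < c /\ forall d, 0 < d -> U (fun N => c <= M (fun x => ind (- d <= G N x))).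
Proof.
intros HU HM H1 HC H0; apply NNPP; intros Hn.
set (m := M (fun _ => 1)) in *.
assert (Hd : forall c, 0 < c -> exists d, 0 < d /\ U (fun N => M (fun x => ind (- d <= G N x)) < c)).
{ intros c Hc; apply NNPP; intros Hc'; apply Hn; exists c; split; [exact Hc |].
  intros d Hd; apply NNPP; intros Hd'; apply Hc'; exists d; split; [exact Hd |].
  apply (ultra_sub U HU _ _ (ultra_not U HU _ Hd')); intros N HN; apply Rnot_le_lt; exact HN. }
destruct (Hd (m / 2) ltac:(lra)) as [d1 [Hd1 K1]].
destruct (ultra_ex U HU _ K1) as [N0 _].
(* On an empty [X] all functions agree and the mass would be 0. A point is needed to know
   [0 <= C]. *)
assert (Hx : exists x : X, True).
{ apply NNPP; intros Hx; apply (Rlt_irrefl 0), (Rlt_le_trans _ _ _ H1).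
  unfold m; rewrite <- (H0 N0); right; apply (mean_ext M HM); [apply bdd_const |].
  intros x; exfalso; apply Hx; exists x; exact I. }
destruct Hx as [x0 _].
assert (HC0 : 0 <= C) by (apply Rle_trans with (2 := HC N0 x0); apply Rabs_pos).
set (c2 := d1 * m / (4 * (C + 1))).
assert (Hc2 : 0 < c2) by (apply Rdiv_lt_0_compat; [apply Rmult_lt_0_compat |]; lra).
destruct (Hd c2 Hc2) as [d2 [Hd2 K2]].
destruct (ultra_ex U HU _ (ultra_and U HU _ _ K1 K2)) as [N [L1 L2]].
(* Pointwise, [G N] is at most [C] where it is at least [- d2], at most [- d1] where it is below
   [- d1], and at most 0 elsewhere. The choice of [c2] then gives [M (G N) <= - d1 * m / 4]. *)
assert (Hle : M (G N) <= C * M (fun x => ind (- d2 <= G N x))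
  + (- d1 * M (fun _ => 1) + d1 * M (fun x => ind (- d1 <= G N x)))).
{ rewrite <- !(mean_scal M HM) by (apply bdd_ind || apply bdd_const).
  assert (Hb : bdd (fun x => - d1 * 1 + d1 * ind (- d1 <= G N x))).
  { apply bdd_plus; apply bdd_mult; apply bdd_const || apply bdd_ind. }
  assert (Hb2 : bdd (fun x => C * ind (- d2 <= G N x))).
  { apply bdd_mult; [apply bdd_const | apply bdd_ind]. }
  rewrite <- (mean_plus M HM) by (apply bdd_mult; apply bdd_const || apply bdd_ind).
  rewrite <- (mean_plus M HM) by assumption.
  apply (mean_le M HM); [exists C; apply HC | apply bdd_plus; assumption |].
  intros x; specialize (HC N x); apply Rabs_le_between in HC; ind_cases; lra. }
rewrite H0 in Hle; fold m in Hle.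
assert (Hs : C * c2 <= d1 * m / 4).
{ apply Rle_trans with ((C + 1) * c2); [apply Rmult_le_compat_r; lra |].
  unfold c2; right; field; lra. }
assert (C * M (fun x => ind (- d2 <= G N x)) <= C * c2) by (apply Rmult_le_compat_l; lra).
assert (d1 * M (fun x => ind (- d1 <= G N x)) <= d1 * (m / 2)) by (apply Rmult_le_compat_l; lra).
assert (0 < d1 * m) by (apply Rmult_lt_0_compat; lra).
lra.
Qed.

Lemma upper_density_avgR Psi E :
  upper_density Psi E = LimSup_seq (fun N => avgR (Psi N) (fun n => ind (E n))).
Proof.
unfold upper_density; f_equal; apply FunctionalExtensionality.functional_extensionality.
intros N; unfold avgR; f_equal.
rewrite <- (Rmult_1_r (INR _)), <- sumR_const, <- sumR_filter.
apply sumR_ext; intros n _; rewrite Rmult_1_r; unfold indicator, ind.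
destruct (excluded_middle_informative (E n)); reflexivity.
Qed.

(** The filter consists of the sets containing some [W k] up to an asymptotically null set. It is
    proper since each [W k] has positive lower density, and it contains the complement of every set
    of upper density 0. *)
Lemma positive_density_ultrafilter (Psi : nat -> list nat) (W : nat -> nat -> Prop) :
  (forall k k' m, (k <= k')%nat -> W k' m -> W k m) ->
  (forall k, exists w, 0 < w /\ eventually (fun i => w <= avgR (Psi i) (fun m => ind (W k m)))) ->
  exists p, is_ultra p /\ (forall k, p (W k)) /\
    forall E, p E -> Rbar_lt (Finite 0) (upper_density Psi E).
Proof.
intros Hmono Hpos.
assert (Hle : forall i (P Q : nat -> Prop), (forall m, P m -> Q m) ->
  avgR (Psi i) (fun m => ind (P m)) <= avgR (Psi i) (fun m => ind (Q m))).
{ intros i P Q H; apply avgR_le; intros m _; specialize (H m); ind_cases; try lra; tauto. }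
assert (Hnull : forall i, avgR (Psi i) (fun _ => ind False) = 0).
{ intros i; unfold avgR; rewrite (sumR_ext _ _ (fun _ => 0)).
  - rewrite sumR_const; unfold Rdiv; ring.
  - intros n _; ind_cases; tauto. }
destruct (ultra_extend nat (fun E => exists k, forall e, 0 < e ->
  eventually (fun i => avgR (Psi i) (fun m => ind (W k m /\ ~ E m)) < e))) as [p [Hp HF]].
- exists 0%nat; intros e He; exists 0%nat; intros i _.
  apply Rle_lt_trans with (2 := He); rewrite <- (Hnull i); apply Hle; tauto.
- intros [k Hk]; destruct (Hpos k) as [w [Hw Hwk]].
  destruct (eventually_and _ _ (Hk w Hw) Hwk) as [i Hi].
  destruct (Hi i (Nat.le_refl i)) as [H1 H2]; apply (Rlt_irrefl w).
  apply Rle_lt_trans with (2 := H1), Rle_trans with (1 := H2), Hle; tauto.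
- intros A B HAB [k Hk]; exists k; intros e He; generalize (Hk e He); apply eventually_mono.
  intros i; apply Rle_lt_trans, Hle; intros m; specialize (HAB m); tauto.
- intros A B [k Hk] [k' Hk']; exists (k + k')%nat; intros e He.
  generalize (eventually_and _ _ (Hk (e / 2) ltac:(lra)) (Hk' (e / 2) ltac:(lra))).
  apply eventually_mono; intros i [H1 H2].
  apply Rle_lt_trans with (avgR (Psi i) (fun m => ind (W k m /\ ~ A m))
    + avgR (Psi i) (fun m => ind (W k' m /\ ~ B m))); [| lra].
  rewrite <- avgR_plus; apply avgR_le; intros m _.
  pose proof (Hmono k (k + k')%nat m ltac:(lia)); pose proof (Hmono k' (k + k')%nat m ltac:(lia)).
  ind_cases; try lra; tauto.
- exists p; split; [exact Hp | split].
  + intros k; apply HF; exists k; intros e He; exists 0%nat; intros i _.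
    apply Rle_lt_trans with (2 := He); rewrite <- (Hnull i); apply Hle; tauto.
  + intros E HE; rewrite upper_density_avgR.
    destruct (Rbar_lt_dec 0 (LimSup_seq (fun N => avgR (Psi N) (fun n => ind (E n))))) as [H|H];
      [exact H | exfalso].
    apply Rbar_not_lt_le in H.
    apply (ultra_not_both p Hp E HE), HF; exists 0%nat; intros e He.
    assert (Hlt : Rbar_lt (LimSup_seq (fun N => avgR (Psi N) (fun n => ind (E n)))) (Finite e)).
    { apply Rbar_le_lt_trans with (Finite 0); [exact H | exact He]. }
    generalize (LimSup_lt_eventually _ _ Hlt); apply eventually_mono; intros i.
    apply Rle_lt_trans, Hle; intros m [_ Hm]; apply NNPP; exact Hm.
Qed.

Lemma inv_S_pos k : 0 < / INR (S k).
Proof. apply Rinv_0_lt_compat, lt_0_INR; lia. Qed.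

Lemma inv_S_eventually e : 0 < e -> eventually (fun k => / INR (S k) < e).
Proof.
intros He; destruct (archimed_cor1 e He) as [N [HN HN0]]; exists N; intros k Hk.
apply Rle_lt_trans with (2 := HN), Rinv_le_contravar; [apply lt_0_INR; lia | apply le_INR; lia].
Qed.

Lemma inv_S_le k k' : (k <= k')%nat -> / INR (S k') <= / INR (S k).
Proof. intros H; apply Rinv_le_contravar; [apply lt_0_INR; lia | apply le_INR; lia]. Qed.

Section Main.
Context (eps : R) (Phi : nat -> list nat) (fBes fanti fc : nat -> R).
Context (Heps : 0 < eps) (HPhi : Folner Phi) (HBes : in_Bes Phi fBes) (Hbb : bdd fBes).
Context (Hanti : in_Bes_perp Phi fanti) (Hab : bdd fanti).
Context (Hcb : bdd fc) (Hc : compact_along Phi fc).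
Context (U : (nat -> Prop) -> Prop) (HU : is_ultra U) (Hfree : forall A, eventually A -> U A).
Notation E := (fmean Phi U).

(** Small enough that [222 * e ^ 2 < (eps / 3) ^ 2], as (U3) will require. *)
Let e := eps / 50.

Definition corr (N m : nat) : R := avgR (Phi N) (fun n => fc n * fanti (n + m)%nat).

Definition err (P : list (C * R)) (N m : nat) : R :=
  avgR (Phi N) (fun n => bes_err fBes P (n + m)%nat ^ 2).

(** The limits along [p0] are unknown when [s] is chosen. Cells centred at naturals [m0] form a
    countable family fixed in advance, which later approximates the sets that determine these
    limits. *)
Definition cell (h : nat -> R) (k m0 m : nat) : Prop :=
  0 < h m /\ forall n, (n <= k)%nat ->
    Rabs (fBes (n + m)%nat - fBes (n + m0)%nat) < / INR (S k) /\
    Rabs (fanti (n + m)%nat - fanti (n + m0)%nat) < / INR (S k).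

(* The last condition makes every cell of positive mean of positive lower density
   along [Phi \o s], which persists along subsequences. *)
Lemma good_indices : exists (P : list (C * R)) (h : nat -> R) (c : R) (s : nat -> nat),
  (forall i j, (i < j)%nat -> (s i < s j)%nat) /\
  eventually (fun N => avgR (Phi N) (fun n => bes_err fBes P n ^ 2) <= e ^ 2) /\
  (forall m, 0 <= h m <= 1) /\ (forall m, 0 < h m -> near Phi fc P (Rmin e (e ^ 2)) m 0) /\
  0 < c /\
  (forall j, c <= E (fun m => h m *
     ind (- / INR (S j) <= corr (s j) m /\ err P (s j) m <= 26 * e ^ 2))) /\
  forall j k m0, (k <= j)%nat -> (m0 <= j)%nat ->
    E (fun m => ind (cell h k m0 m)) / 2 <= avgR (Phi (s j)) (fun m => ind (cell h k m0 m)).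
Proof.
assert (He : 0 < e) by (unfold e; lra).
assert (He2 : 0 < e ^ 2) by (apply pow_lt; exact He).
pose proof (fmean_mean Phi HPhi U HU) as HM.
destruct (HBes e He) as [P [_ HP]].
assert (HP' : eventually (fun N => avgR (Phi N) (fun n => bes_err fBes P n ^ 2) <= e ^ 2)).
{ generalize (normC_lt_eventually _ _ _ He HP); apply eventually_mono; intros N HN.
  unfold bes_err; lra. }
destruct (near_weight Phi HPhi U HU Hfree fc P (Rmin e (e ^ 2)) Hcb Hc
  ltac:(apply Rmin_pos; lra)) as [h [Hh [Hnear [HE Horth]]]].
assert (Hhb : bdd h) by (exists 1; intros m; apply Rabs_le; specialize (Hh m); lra).
destruct (bdd_pos fanti Hab) as [Ba [HBa0 HBa]].
destruct (bdd_pos fc Hcb) as [Bc [HBc0 HBc]].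
assert (HG : forall N m, Rabs (corr N m) <= Bc * Ba).
{ intros N m; apply avgR_abs_le; [apply Rmult_le_pos; lra |].
  intros n; rewrite Rabs_mult; apply Rmult_le_compat; auto using Rabs_pos. }
set (lam := fun f : nat -> R => E (fun m => h m * f m)).
assert (Hlam : is_mean lam).
{ apply (weighted_mean E h HM Hhb); intros m; apply Hh. }
assert (Hfa : forall n, bdd (fun m => fanti (n + m)%nat)).
{ intros n; apply (bdd_comp fanti (fun m => (n + m)%nat) Hab). }
destruct (uniform_nonnegative_mass U lam corr (Bc * Ba)) as [c [Hc0 Hcorr]]; auto.
{ unfold lam; rewrite (mean_ext E HM _ h); [exact HE | | intros; ring].
  apply bdd_mult; [exact Hhb | apply bdd_const]. }
{ intros N; unfold corr.
  rewrite (mean_avgR lam Hlam (Phi N) (fun n m => fc n * fanti (n + m)%nat)).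
  - rewrite (avgR_ext _ _ (fun _ => 0)).
    + rewrite avgR_const; [reflexivity | apply (Folner_nonempty Phi HPhi)].
    + intros n _; rewrite (mean_scal lam Hlam) by apply Hfa.
      unfold lam; rewrite Horth by assumption; ring.
  - intros n; apply bdd_mult; [apply bdd_const | apply Hfa]. }
set (S' := fun j N => c <= lam (fun m => ind (- / INR (S j) <= corr N m)) /\
  E (fun m => ind (26 * e ^ 2 < err P N m)) <= c / 2 /\
  forall k, (k <= j)%nat -> forall m0, (m0 <= j)%nat ->
    E (fun m => ind (cell h k m0 m)) / 2 <= avgR (Phi N) (fun m => ind (cell h k m0 m))).
assert (HS : forall j, U (S' j)).
{ intros j; apply (ultra_and U HU); [| apply (ultra_and U HU)].
  - apply Hcorr, inv_S_pos.
  - apply Hfree, (bes_err_shift_average Phi HPhi U HU Hfree fBes P e (c / 2)); auto; lra.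
  - apply (ultra_forall_le U HU); intros k _; apply (ultra_forall_le U HU); intros m0 _.
    set (f := fun m => ind (cell h k m0 m)).
    assert (Hf : bdd f) by apply bdd_ind.
    assert (Hf0 : 0 <= E f) by apply (mean_ind_bounds E HM).
    (* For a positive mean, [U]-many averages exceed half of it; for mean 0 the bound is trivial. *)
    destruct (Rle_lt_or_eq_dec _ _ Hf0) as [Hlt|Heq].
    + apply (ultra_sub U HU _ _ (fmean_ulimit Phi HPhi U HU f Hf (E f / 2) ltac:(lra))).
      intros N HN; apply Rabs_def2 in HN; lra.
    + apply (ultra_all U HU); intros N; rewrite <- Heq.
      replace (0 / 2) with 0 by field; apply avgR_nonneg; intros m _; apply ind_bounds. }
destruct (increasing_selection S') as [s [Hs HSs]].
{ intros j n.
  destruct (ultra_ex U HU (fun N => S' j N /\ (n < N)%nat)) as [N [H1 H2]].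
  - apply (ultra_and U HU); [apply HS | apply Hfree; exists (S n); lia].
  - exists N; split; assumption. }
exists P, h, (c / 2), s; do 4 (split; [assumption |]); split; [lra | split].
- intros j; destruct (HSs j) as [H1 [H2 _]].
  (* Since [h <= 1], discarding the [m] of large error costs at most their mean, which is at most
     [c / 2]; hence the final constant [c / 2]. *)
  assert (H3 : lam (fun m => ind (- / INR (S j) <= corr (s j) m))
    <= E (fun m => h m * ind (- / INR (S j) <= corr (s j) m /\ err P (s j) m <= 26 * e ^ 2))
       + E (fun m => ind (26 * e ^ 2 < err P (s j) m))).
  { unfold lam; rewrite <- (mean_plus E HM) by (apply bdd_ind || (apply bdd_mult; [exact Hhb | apply bdd_ind])).
    apply (mean_le E HM).
    - apply bdd_mult; [exact Hhb | apply bdd_ind].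
    - apply bdd_plus; [apply bdd_mult; [exact Hhb |] |]; apply bdd_ind.
    - intros m; specialize (Hh m).
      destruct (Rle_or_lt (err P (s j) m) (26 * e ^ 2)); ind_cases; try lra; tauto. }
  lra.
- intros j k m0 Hk Hm0; destruct (HSs j) as [_ [_ H3]]; auto.
Qed.

Lemma eventually_subseq (s : nat -> nat) (Q : nat -> Prop) :
  (forall i j, (i < j)%nat -> (s i < s j)%nat) -> eventually Q -> eventually (fun k => Q (s k)).
Proof.
intros Hs [N HN]; exists N; intros k Hk; apply HN.
pose proof (increasing_ge_id s Hs k); lia.
Qed.

Lemma bes_compact_ultrafilter :
  exists (Psi : nat -> list nat) (p : (nat -> Prop) -> Prop),
    is_subsequence Psi Phi /\ is_ultrafilter p /\
    (forall E, p E -> Rbar_lt (Finite 0) (upper_density Psi E)) /\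
    p (fun n => Rbar_lt (normR Psi (fun x => Rshift n fc x - fc x)) (Finite (eps / 3))) /\
    Rbar_lt (normR Psi (fun x => ushift p fBes x - fBes x)) (Finite (eps / 3)) /\
    (exists l, inner_is Psi fc (ushift p fanti) l /\ 0 <= l).
Proof.
assert (He : 0 < e) by (unfold e; lra).
assert (He2 : 0 < e ^ 2) by (apply pow_lt; exact He).
pose proof (fmean_mean Phi HPhi U HU) as HM.
destruct good_indices as [P [h [c [s [Hs [HP [Hh [Hnear [Hc0 [HA Hcell]]]]]]]]]].
assert (Hhb : bdd h) by (exists 1; intros m; apply Rabs_le; specialize (Hh m); lra).
set (A := fun j m => - / INR (S j) <= corr (s j) m /\ err P (s j) m <= 26 * e ^ 2).
assert (Hlam : is_mean (fun f : nat -> R => E (fun m => h m * f m))).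
{ apply (weighted_mean E h HM Hhb); intros m; apply Hh. }
destruct (intersectivity _ A c Hlam Hc0 HA) as [p0 [Hp0 [Hpos Hio]]].
assert (Hlim : forall f, bdd f -> exists L : nat -> R,
  forall n, is_ulimit p0 (fun m => f (n + m)%nat) (L n)).
{ intros f [B HB]; exists (fun n => ulimit p0 (fun m => f (n + m)%nat)); intros n.
  apply (ulimit_correct p0 Hp0); exists B; intros m; apply HB. }
destruct (Hlim fBes Hbb) as [Lb HLb]; destruct (Hlim fanti Hab) as [La HLa].
(* Members of [p0] have positive measure for the mean weighted by [h], which vanishes where [h] is
   0. *)
assert (Hh0 : p0 (fun m => 0 < h m)).
{ apply NNPP; intros Hn; apply (ultra_not p0 Hp0), Hpos in Hn.
  rewrite (mean_ext E HM _ (fun _ => 0)) in Hn.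
  - rewrite (mean_const E HM) in Hn; lra.
  - apply bdd_mult; [exact Hhb | apply bdd_ind].
  - intros m; specialize (Hh m); ind_cases; [| ring].
    assert (h m = 0) by lra; rewrite H0; ring. }
assert (Hclose : forall k d, 0 < d -> p0 (fun m => forall n, (n <= k)%nat ->
  Rabs (fBes (n + m)%nat - Lb n) < d /\ Rabs (fanti (n + m)%nat - La n) < d)).
{ intros k d Hd; apply (ultra_forall_le p0 Hp0); intros n _.
  apply (ultra_and p0 Hp0); [apply HLb | apply HLa]; exact Hd. }
destruct (increasing_selection (fun _ j => p0 (A j))) as [t [Ht HAt]].
{ intros _ n; destruct (Hio (S n)) as [j [Hj HAj]]; exists j; split; [lia | exact HAj]. }
destruct (bdd_pos fc Hcb) as [Bc [HBc0 HBc]].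
assert (HLab : exists Ba, forall n, Rabs (La n) <= Ba).
{ destruct Hab as [Ba HBa]; exists (Ba + 1); intros n.
  destruct (ultra_ex p0 Hp0 _ (HLa n 1 Rlt_0_1)) as [m Hm].
  specialize (HBa (n + m)%nat); apply Rabs_le_between in HBa; apply Rabs_def2 in Hm.
  apply Rabs_le; lra. }
set (x := fun i => avgR (Phi (s (t i))) (fun n => fc n * La n)).
assert (Hx : is_ulimit U x (ulimit U x)).
{ destruct HLab as [Ba HBa].
  apply (ulimit_correct U HU), (bdd_avgR (fun i => Phi (s (t i))) (fun _ n => fc n * La n) (Bc * Ba)).
  intros _ n; rewrite Rabs_mult; apply Rmult_le_compat; auto using Rabs_pos. }
set (l := ulimit U x) in *.
(* Only finitely many [n] matter at stage [i], so a single [m] in [A (t i)] realises both limits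
   there up to [d]. *)
assert (Happrox : forall i d, 0 < d -> exists m, A (t i) m /\ 0 < h m /\
  forall n, In n (Phi (s (t i))) ->
    Rabs (fBes (n + m)%nat - Lb n) < d /\ Rabs (fanti (n + m)%nat - La n) < d).
{ intros i d Hd.
  destruct (ultra_ex p0 Hp0 _ (ultra_and p0 Hp0 _ _ (HAt i) (ultra_and p0 Hp0 _ _ Hh0
    (Hclose (list_max (Phi (s (t i)))) d Hd)))) as [m [H1 [H2 H3]]].
  exists m; repeat split; try apply H1; auto; apply H3, list_max_In; assumption. }
assert (Hxlow : forall i, - / INR (S i) <= x i).
{ intros i; apply Rle_trans with (- / INR (S (t i))).
  { apply Ropp_le_contravar, inv_S_le, increasing_ge_id; exact Ht. }
  apply Rnot_lt_le; intros Hlt.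
  set (y := - / INR (S (t i)) - x i).
  assert (Hy : 0 < y) by (unfold y; lra).
  (* Replacing [La] by a translate of [fanti] then changes the average by at most [y / 2], too
     little to reach the lower bound valid on [A (t i)]. *)
  set (d := y / (2 * Bc)).
  assert (Hd : 0 < d) by (apply Rdiv_lt_0_compat; lra).
  destruct (Happrox i d Hd) as [m [[HAm _] [_ Hm]]].
  assert (Hle : corr (s (t i)) m <= avgR (Phi (s (t i))) (fun n => fc n * La n + Bc * d)).
  { apply avgR_le; intros n Hn; destruct (Hm n Hn) as [_ Hn2]; left.
    apply Rplus_lt_reg_l with (- (fc n * La n)).
    replace (- (fc n * La n) + fc n * fanti (n + m)%nat) with (fc n * (fanti (n + m)%nat - La n)) by ring.
    replace (- (fc n * La n) + (fc n * La n + Bc * d)) with (Bc * d) by ring.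
    apply Rle_lt_trans with (1 := Rle_abs _); rewrite Rabs_mult.
    apply Rle_lt_trans with (Bc * Rabs (fanti (n + m)%nat - La n)).
    - apply Rmult_le_compat_r; [apply Rabs_pos | apply HBc].
    - apply Rmult_lt_compat_l; lra. }
  rewrite avgR_plus, avgR_const in Hle by apply (Folner_nonempty Phi HPhi); fold (x i) in Hle.
  assert (Bc * d = y / 2) by (unfold d; field; lra).
  unfold y in *.
  lra. }
assert (Hl : 0 <= l).
{ apply Rnot_lt_le; intros Hlt.
  pose proof (Hfree _ (inv_S_eventually (- l / 2) ltac:(lra))) as H1.
  destruct (ultra_ex U HU _ (ultra_and U HU _ _ H1 (Hx (- l / 2) ltac:(lra)))) as [i [K1 K2]].
  specialize (Hxlow i); apply Rabs_def2 in K2; lra. }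
(* A further thinning makes the correlations with [La] converge to [l], as (U4) demands an actual
   limit. *)
destruct (increasing_selection (fun k i => Rabs (x i - l) < / INR (S k))) as [r [Hr Hrx]].
{ intros k n.
  assert (H1 : U (fun i => (n < i)%nat)) by (apply Hfree; exists (S n); lia).
  apply (ultra_ex U HU _ (ultra_and U HU _ _ H1 (Hx _ (inv_S_pos k)))). }
set (sg := fun k => s (t (r k))).
assert (Hsg : forall i j, (i < j)%nat -> (sg i < sg j)%nat) by (intros i j Hij; apply Hs, Ht, Hr, Hij).
set (Psi := fun k => Phi (sg k)).
set (W := fun k m => 0 < h m /\ forall n, (n <= k)%nat ->
  Rabs (fBes (n + m)%nat - Lb n) < / INR (S k) /\ Rabs (fanti (n + m)%nat - La n) < / INR (S k)).
assert (HW : forall k, p0 (W k)).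
{ intros k; apply (ultra_and p0 Hp0); [exact Hh0 | apply Hclose, inv_S_pos]. }
destruct (positive_density_ultrafilter Psi W) as [p [Hp [HpW Hdens]]].
- intros k k' m Hk [H1 H2]; split; [exact H1 |]; intros n Hn.
  pose proof (inv_S_le k k' Hk); destruct (H2 n ltac:(lia)); lra.
- intros k.
  (* Chosen so that [S k1 = 2 * S k] and [S k2 = 4 * S k]. For [m0] in [W k2] this gives [W k2]
     inside [cell h k1 m0] inside [W k], with tolerances [1/4 + 1/4 = 1/2] and [1/2 + 1/4 < 1] in
     units of [/ INR (S k)]. *)
  set (k1 := (2 * k + 1)%nat); set (k2 := (4 * k + 3)%nat).
  assert (Hk1 : / INR (S k1) = / INR (S k) / 2).
  { replace (S k1) with (2 * S k)%nat by (unfold k1; lia); rewrite mult_INR.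
    pose proof (lt_0_INR (S k) ltac:(lia)); simpl (INR 2); field; lra. }
  assert (Hk2 : / INR (S k2) = / INR (S k) / 4).
  { replace (S k2) with (4 * S k)%nat by (unfold k2; lia); rewrite mult_INR.
    pose proof (lt_0_INR (S k) ltac:(lia)); replace (INR 4) with 4 by (simpl; ring); field; lra. }
  pose proof (inv_S_pos k) as Hk0.
  destruct (ultra_ex p0 Hp0 _ (HW k2)) as [m0 [_ Hm0]].
  assert (H1 : 0 < E (fun m => ind (cell h k1 m0 m))).
  { apply Rlt_le_trans with (1 := Hpos _ (HW k2)).
    apply (mean_le E HM); [apply bdd_mult; [exact Hhb | apply bdd_ind] | apply bdd_ind |].
    intros m; specialize (Hh m).
    destruct (ind_spec (W k2 m)) as [[[Hm1 Hm2] ->]|[_ ->]].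
    - destruct (ind_spec (cell h k1 m0 m)) as [[_ ->]|[Hn _]]; [lra |].
      exfalso; apply Hn; split; [exact Hm1 |]; intros n Hkn.
      rewrite Hk1; rewrite Hk2 in Hm0, Hm2.
      destruct (Hm0 n ltac:(unfold k1, k2 in *; lia)) as [Q1 Q2].
      destruct (Hm2 n ltac:(unfold k1, k2 in *; lia)) as [Q3 Q4].
      apply Rabs_def2 in Q1; apply Rabs_def2 in Q2; apply Rabs_def2 in Q3; apply Rabs_def2 in Q4.
      split; apply Rabs_def1; lra.
    - rewrite Rmult_0_r; apply ind_bounds. }
  exists (E (fun m => ind (cell h k1 m0 m)) / 2); split; [lra |].
  exists (k1 + m0)%nat; intros i Hi.
  pose proof (increasing_ge_id r Hr i); pose proof (increasing_ge_id t Ht (r i)).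
  apply Rle_trans with (1 := Hcell (t (r i)) k1 m0 ltac:(lia) ltac:(lia)).
  apply avgR_le; intros m _.
  destruct (ind_spec (cell h k1 m0 m)) as [[[Hm1 Hm2] ->]|[_ ->]]; [| apply ind_bounds].
  destruct (ind_spec (W k m)) as [[_ ->]|[Hn _]]; [lra |].
  exfalso; apply Hn; split; [exact Hm1 |]; intros n Hkn.
  rewrite Hk1 in Hm2; rewrite Hk2 in Hm0.
  destruct (Hm0 n ltac:(unfold k1, k2 in *; lia)) as [Q1 Q2].
  destruct (Hm2 n ltac:(unfold k1, k2 in *; lia)) as [Q3 Q4].
  apply Rabs_def2 in Q1; apply Rabs_def2 in Q2; apply Rabs_def2 in Q3; apply Rabs_def2 in Q4.
  split; apply Rabs_def1; lra.
(* [p] contains every [W k], hence has the same limits [Lb] and [La] as [p0]. *)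
- assert (HpL : forall n d, 0 < d -> p (fun m =>
    Rabs (fBes (n + m)%nat - Lb n) < d /\ Rabs (fanti (n + m)%nat - La n) < d)).
  { intros n d Hd; destruct (inv_S_eventually d Hd) as [N HN].
    apply (ultra_sub p Hp _ _ (HpW (N + n)%nat)); intros m [_ Hm].
    specialize (HN (N + n)%nat ltac:(lia)); destruct (Hm n ltac:(lia)); lra. }
  assert (Hub : forall n, ushift p fBes n = Lb n).
  { intros n; apply (ulimit_eq p Hp (fun m => fBes (n + m)%nat)); intros d Hd.
    apply (ultra_sub p Hp _ _ (HpL n d Hd)); tauto. }
  assert (Hua : forall n, ushift p fanti n = La n).
  { intros n; apply (ulimit_eq p Hp (fun m => fanti (n + m)%nat)); intros d Hd.
    apply (ultra_sub p Hp _ _ (HpL n d Hd)); tauto. }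
  exists Psi, p; split; [exists sg; split; [exact Hsg | reflexivity] |].
  split; [exact Hp | split; [exact Hdens | split; [| split]]].
  (* (U2): [h] is positive on [W 0], so its elements are within [e ^ 2] of 0 in squared distance. *)
  + apply (ultra_sub p Hp _ _ (HpW 0%nat)); intros m [Hm _].
    destruct (Hnear m Hm) as [Hq _].
    apply (normR_lt_intro _ _ _ (e ^ 2)); [lra | unfold e; nra |].
    generalize (eventually_subseq sg _ Hsg Hq); apply eventually_mono; intros k Hk.
    apply Rle_trans with (2 := Rmin_r e (e ^ 2)), Rle_trans with (2 := Hk).
    right; apply avgR_ext; intros n _; unfold Rshift; rewrite Nat.add_0_r; reflexivity.
  + apply (normR_lt_intro _ _ _ (222 * e ^ 2)); [lra | unfold e; nra |].
    generalize (eventually_subseq sg _ Hsg HP); apply eventually_mono; intros k Hk.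
    (* (U3): this [m] depends on [k], but its translate of [fBes] stays within [e] of the fixed
       limit [Lb] on [Psi k]. Comparison with [trigpoly P] at [n + m] and at [n] gives
       [8 * 26 + 8 + 6 = 222]. *)
    destruct (Happrox (r k) e He) as [m [[_ HVm] [Hm Hmc]]].
    destruct (Hnear m Hm) as [_ Hmt].
    pose proof (Rmin_l e (e ^ 2)) as Hmin.
    apply Rle_trans with (avgR (Psi k) (fun n => 8 * bes_err fBes P (n + m)%nat ^ 2
      + (8 * bes_err fBes P n ^ 2 + 6 * e ^ 2))).
    * apply avgR_le; intros n Hn; rewrite Hub.
      destruct (Hmc n Hn) as [Hn1 _].
      pose proof (tdist_spec P n m 0) as Htd; rewrite Nat.add_0_r in Htd.
      assert (H1 : Rabs (fBes (n + m)%nat - fBes n)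
        <= (bes_err fBes P (n + m)%nat + bes_err fBes P n) + e).
      { rewrite <- Cmod_R, RtoC_minus; unfold bes_err.
        replace (fBes (n + m)%nat - fBes n)%C
          with (((fBes (n + m)%nat - trigpoly P (n + m)) + - (fBes n - trigpoly P n))
                + (trigpoly P (n + m) - trigpoly P n))%C by ring.
        apply Rle_trans with (1 := Cmod_triangle _ _); apply Rplus_le_compat; [| lra].
        apply Rle_trans with (1 := Cmod_triangle _ _); rewrite Cmod_opp; lra. }
      assert (H2 : (fBes (n + m)%nat - fBes n) ^ 2
        <= 2 * (2 * bes_err fBes P (n + m)%nat ^ 2 + 2 * bes_err fBes P n ^ 2) + 2 * e ^ 2).
      { rewrite <- pow2_abs.
        apply Rle_trans with (((bes_err fBes P (n + m)%nat + bes_err fBes P n) + e) ^ 2).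
        - apply pow_incr; split; [apply Rabs_pos | exact H1].
        - apply Rle_trans with (1 := sq_plus_le _ _).
          pose proof (sq_plus_le (bes_err fBes P (n + m)%nat) (bes_err fBes P n)); lra. }
      assert (H3 : (Lb n - fBes (n + m)%nat) ^ 2 <= e ^ 2).
      { rewrite <- pow2_abs; apply pow_incr; split; [apply Rabs_pos |].
        rewrite Rabs_minus_sym; lra. }
      replace (Lb n - fBes n) with ((Lb n - fBes (n + m)%nat) + (fBes (n + m)%nat - fBes n)) by ring.
      apply Rle_trans with (1 := sq_plus_le _ _); lra.
    * rewrite !avgR_plus, !avgR_scal, avgR_const by apply (Folner_nonempty Phi HPhi).
      unfold err in HVm; fold (sg k) in HVm; fold (Psi k) in HVm, Hk; lra.
  + exists l; split; [| exact Hl].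
    apply lim_seq_eps; intros d Hd; generalize (inv_S_eventually d Hd); apply eventually_mono.
    intros k Hk; apply Rlt_trans with (2 := Hk).
    rewrite (avgR_ext _ _ (fun n => fc n * La n)); [exact (Hrx k) |].
    intros n _; rewrite Hua; reflexivity.
Qed.

End Main.

Theorem theorem4p1 (eps : R) (Phi : nat -> list nat)
  (fBes fanti fc : nat -> R) :
  0 < eps ->
  Folner Phi ->
  in_Bes Phi fBes -> bounded_seq fBes -> (forall n, 0 <= fBes n) ->
  in_Bes_perp Phi fanti -> bounded_seq fanti ->
  L2 Phi fc -> bounded_seq fc -> (forall n, 0 <= fc n) -> compact_along Phi fc ->
  exists (Psi : nat -> list nat) (p : (nat -> Prop) -> Prop),
    is_subsequence Psi Phi /\ is_ultrafilter p /\
    (forall E, p E -> Rbar_lt (Finite 0) (upper_density Psi E)) /\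
    p (fun n => Rbar_lt (normR Psi (fun x => Rshift n fc x - fc x)) (Finite (eps / 3))) /\
    Rbar_lt (normR Psi (fun x => ushift p fBes x - fBes x)) (Finite (eps / 3)) /\
    (exists l, inner_is Psi fc (ushift p fanti) l /\ 0 <= l).
Proof.
intros Heps HPhi HBes Hbb _ Hanti Hab _ Hcb _ Hc.
destruct free_ultra_ex as [U [HU Hfree]].
exact (bes_compact_ultrafilter eps Phi fBes fanti fc Heps HPhi HBes Hbb Hanti Hab Hcb Hc U HU Hfree).
Qed.
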